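(* Let $D\subset B\subset M$ be unital complex algebras (unital inclusions), let $E:M\to B$ and $F:B\to D$ be conditional expectations, and regard $M$ as a $B$-probability space via $E$ and as a $D$-probability space via $F\circ E$. Assume that $F$ satisfies the following faithfulness condition: if $b_1\in B$ and $F(b_1b_2)=0$ for all $b_2\in B$, then $b_1=0$. Let $X_1,\dots,X_n\in M$. Then $X_1,\dots,X_n$ are free from $B$ with amalgamation over $D$ if and only if their $B$-valued cumulant series satisfies $$k^{X_1,\dots,X_n}_{B;i_1,\dots,i_k}(b_1,\dots,b_{k-1})=F\bigl(k^{X_1,\dots,X_n}_{B;i_1,\dots,i_k}(F(b_1),\dots,F(b_{k-1}))\bigr)$$ for all $k\ge 1$, all $1\le i_1,\dots,i_k\le n$ and all $b_1,\dots,b_{k-1}\in B$. Equivalently (i.e. this freeness is also equivalent to the following condition), $$k^{X_1,\dots,X_n}_{B;i_1,\dots,i_k}(b_1,\dots,b_{k-1})=k^{X_1,\dots,X_n}_{D;i_1,\dots,i_k}(F(b_1),\dots,F(b_{k-1}))$$ for all $k\ge 1$, all $1\le i_1,\dots,i_k\le n$ and all $b_1,\dots,b_{k-1}\in B$.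
   Context: A conditional expectation $E:M\to B$ onto a unital subalgebra $B\subset M$ is a linear map with $E(1)=1$ and $E(bmb')=bE(m)b'$ for $b,b'\in B$, $m\in M$; then $(M,E)$ is called a $B$-probability space. Cumulants: the $B$-valued cumulants $\kappa^B$ are the $\mathbb C$-multilinear maps $\kappa^B:M^n\to B$ ($n\ge1$) which are $B$-balanced, i.e. $\kappa^B(bm_1,\dots,m_n)=b\,\kappa^B(m_1,\dots,m_n)$, $\kappa^B(m_1,\dots,m_nb)=\kappa^B(m_1,\dots,m_n)b$, $\kappa^B(\dots,m_jb,m_{j+1},\dots)=\kappa^B(\dots,m_j,bm_{j+1},\dots)$, uniquely determined by the moment-cumulant formula $E(m_1\cdots m_n)=\sum_{\pi\in NC(n)}\kappa^B_\pi(m_1,\dots,m_n)$. Here $NC(n)$ is the set of non-crossing partitions of $\{1,\dots,n\}$, $\kappa^B_{1_n}=\kappa^B$ for the one-block partition $1_n$, and $\kappa^B_\pi$ is obtained by nested bracketing: if $\{p+1,\dots,p+q\}$ is an interval block of $\pi$ (not the only block), then $\kappa^B_\pi(m_1,\dots,m_n)=\kappa^B_{\pi'}(m_1,\dots,m_p\,\kappa^B(m_{p+1},\dots,m_{p+q}),m_{p+q+1},\dots,m_n)$, where $\pi'$ is $\pi$ with this block removed (for $p=0$ the inserted value multiplies $m_{q+1}$ from the left). $\kappa^D$ is defined in the same way from the expectation $F\circ E:M\to D$. Cumulant series: $k^{X_1,\dots,X_n}_{B;i_1,\dots,i_k}(b_1,\dots,b_{k-1})=\kappa^B(X_{i_1}b_1,X_{i_2}b_2,\dots,X_{i_{k-1}}b_{k-1},X_{i_k})$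 for $b_j\in B$, and similarly $k_D$ using $\kappa^D$ and arguments from $D$. Freeness: two subalgebras $M_1,M_2\subset M$ containing $D$ are free with amalgamation over $D$ if $E_D(a_1\cdots a_s)=0$ (where $E_D=F\circ E$) whenever $E_D(a_j)=0$ for all $j$ and the $a_j$ come alternately from $M_1$ and $M_2$. $X_1,\dots,X_n$ are free from $B$ with amalgamation over $D$ if the algebra generated by $D$ and $X_1,\dots,X_n$ is free from $B$ with amalgamation over $D$. *)

(* Defs.v *)
From mathcomp Require Import all_boot all_order all_algebra.
From mathcomp Require classical_sets.
From mathcomp Require Import reals complex.

Set Implicit Arguments.
Unset Strict Implicit.
Unset Printing Implicit Defensive.

Import GRing.Theory.

Local Open Scope ring_scope.

(* An inclusion of unital algebras [B] in [M] is given by an injective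
   algebra morphism [inc : B -> M], and the values of an expectation onto [B]
   are of type [B]. *)

Definition cond_exp (K : pzRingType) (B M : algType K) (inc : B -> M)
    (E : {linear M -> B}) :=
  E 1 = 1 /\ forall b m b', E (inc b * m * inc b') = b * E m * b'.

Definition noncrossing n (P : {set {set 'I_n}}) :=
  [forall V in P, forall W in P,
     [exists i in V, exists j in W, exists k in V, exists l in W,
        [&& i < j, j < k & k < l]%N] ==> (V == W)].

Definition NC n : {set {set {set 'I_n}}} :=
  [set P : {set {set 'I_n}} | partition P [set: 'I_n] && noncrossing P].

(* Nested bracketing is performed on the sequence [m] of the arguments together
   with a sequence [s] of labels of the same size: two positions are in the same
   block if and only if they have the same label. Thus the positions which
   remain after the removal of a block keep their labels. *)

Section Bracketing.
Context {L : eqType} {B M : pzRingType}.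
Variables (inc : B -> M) (kappa : seq M -> B).
Implicit Types (s : seq L) (m : seq M).

Definition block_size s p :=
  if drop p s is l :: _ then count_mem l s else 0%N.

(* The block of the position [p] is [p, ..., p + block_size s p - 1]. *)
Definition interval_at s p :=
  if drop p s is l :: _
  then take (block_size s p) (drop p s) == nseq (block_size s p) l
  else false.

(* [x] multiplies the last element of [u] from the right or, when [u] is empty,
   the first element of [t] from the left. *)
Fixpoint insert (u : seq M) (x : M) (t : seq M) : seq M :=
  match u with
  | [::] => if t is y :: t' then x * y :: t' else [::]
  | [:: y] => y * x :: t
  | y :: u' => y :: insert u' x t
  end.

Definition del_labels s p q := take p s ++ drop (p + q) s.

Definition del_args m p q :=
  insert (take p m) (inc (kappa (take q (drop p m)))) (drop (p + q) m).

(* The leftmost interval block is removed; by [bracket_interval] below, any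
   other interval block gives the same value. The value is 0 if there is no
   interval block, which does not happen for a non-crossing partition. *)
Fixpoint bracket_rec (f : nat) s m : B :=
  if constant s then kappa m else
  let p := find (interval_at s) (iota 0 (size s)) in
  let q := block_size s p in
  if f is f'.+1 then
    if (p < size s)%N
    then bracket_rec f' (del_labels s p q) (del_args m p q)
    else 0
  else 0.

Definition bracket s m := bracket_rec (size s) s m.

End Bracketing.

Definition cumulant_part (B M : pzRingType) (inc : B -> M)
    (kappa : seq M -> B) n (P : {set {set 'I_n}}) (m : 'I_n -> M) : B :=
  bracket inc kappa [seq pblock P i | i <- enum 'I_n] [seq m i | i <- enum 'I_n].

(* Cumulants with any number n >= 1 of arguments are given by one function on
   sequences; its value at the empty sequence is irrelevant. *)

Definition multilinear (K : pzRingType) (M B : lmodType K)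
    (kappa : seq M -> B) :=
  forall u v a x y,
    kappa (u ++ (a *: x + y) :: v) =
    a *: kappa (u ++ x :: v) + kappa (u ++ y :: v).

Definition balanced (B M : pzRingType) (inc : B -> M) (kappa : seq M -> B) :=
  [/\ forall b m v, kappa (inc b * m :: v) = b * kappa (m :: v),
      forall u m b, kappa (rcons u (m * inc b)) = kappa (rcons u m) * b
    & forall u m b m' v,
        kappa (u ++ m * inc b :: m' :: v) = kappa (u ++ m :: inc b * m' :: v)].

Definition is_cumulants (K : pzRingType) (B M : algType K) (inc : B -> M)
    (E : M -> B) (kappa : seq M -> B) :=
  [/\ multilinear kappa, balanced inc kappa
    & forall n (m : 'I_n.+1 -> M),
        E (\prod_i m i) = \sum_(P in NC n.+1) cumulant_part inc kappa P m].

Definition cumulant_series (B M : pzRingType) (inc : B -> M)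
    (kappa : seq M -> B) n (X : 'I_n -> M) k (i : 'I_k.+1 -> 'I_n)
    (b : 'I_k -> B) : B :=
  kappa (rcons [seq X (i (widen_ord (leqnSn k) j)) * inc (b j) | j <- enum 'I_k]
               (X (i ord_max))).

Import classical_sets.

Definition generated_alg (K : pzRingType) (M : algType K) (G : set M) : set M :=
  smallest (fun A : set M => GRing.subalg_closed (mem A)) G.

(* The elements [a 0, a 1, ...] come alternately from the two sets, with [a 0]
   in [M2] if [c] and in [M1] otherwise. *)
Definition free_amalg (D M : pzRingType) (E : M -> D) (M1 M2 : set M) :=
  forall s (a : 'I_s.+1 -> M) (c : bool),
    (forall j : 'I_s.+1, (if c (+) odd j then M2 else M1) (a j)) ->
    (forall j, E (a j) = 0) ->
    E (\prod_j a j) = 0.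

Definition free_from (K : pzRingType) (D B M : algType K) (incDB : D -> B)
    (incBM : B -> M) (E : M -> D) n (X : 'I_n -> M) :=
  free_amalg E (generated_alg (range (incBM \o incDB) `|` range X)%classic)
    (range incBM).

(* Main.v *)
(* Scanning a word from the right, one decides for each letter whether it is in
   the block of the first letter; this turns the moment-cumulant formula into a
   recursion in which every gap of this block contributes a value of [E].

   Let (Z) be the vanishing of E(w0 b1 a1 ... br ar), r >= 1, for words w0, wi in
   X and D, ai = wi - E(wi) and F(bi) = 0. If kB vanishes as soon as one of its
   inner coefficients is F-centred, then in the recursion for such a product any
   block that jumps over some bi has a gap with an F-centred expectation, and (Z)
   follows by induction on the number of letters; (Z), together with E(w) in D,
   gives freeness. Conversely, freeness and the faithfulness of F give (Z) and
   E(w) in D; all terms of the recursion except the cumulant of highest order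
   vanish by induction, hence so does this cumulant when a coefficient is
   F-centred. By multilinearity kB only depends on the F(bj), and on coefficients
   in D the recursions for kB and kD coincide. *)

Require Import Defs.
From mathcomp Require Import all_boot all_order all_algebra.
From mathcomp Require Import zify.

Set Implicit Arguments.
Unset Strict Implicit.
Unset Printing Implicit Defensive.

Import GRing.Theory.

Local Open Scope ring_scope.

(** Two obstacles shape the argument. The bracket is defined by always removing the leftmost
    interval block, so a gap of the block of the first letter is not bracketed in one piece; it must
    be shown that it could be, before the sum over its partitions can be recognised as a value of
    [E]. Moreover a factor [w - E(w)] is not a letter, and expanding a product of such factors would
    destroy the cancellation. Reading a letter is therefore made an operator on functionals of the
    open gap and of the block collected so far; a centred factor becomes a difference of such
    operators, and vanishing is proved for the operators. Freeness speaks about [F(E(...))] only. To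
    get statements about [E], a further F-centred element of [B] is appended to the product, which
    keeps it alternating; faithfulness of [F] then removes it. The coefficient after the last letter
    of a block comes out of the cumulant and kills nothing. This is why only inner coefficients
    matter, and why the last centred factor of a product needs a separate treatment. *)

(** * Nested brackets *)

Section Blocks.
Context {L : eqType}.
Implicit Types (s a c : seq L) (l : L).

Definition is_block s a l q c := s = a ++ nseq q.+1 l ++ c /\ l \notin a ++ c.

Lemma drop_block s a l q c : is_block s a l q c ->
  drop (size a) s = l :: nseq q l ++ c.
Proof. by case=> -> _; rewrite drop_size_cat. Qed.

Lemma block_size_block s a l q c : is_block s a l q c ->
  block_size s (size a) = q.+1.
Proof.
move=> h; rewrite /block_size (drop_block h).
case: h => -> h; rewrite !count_cat count_nseq /= eqxx mul1n.
move: h; rewrite mem_cat negb_or => /andP[ha hc].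
by rewrite (count_memPn ha) (count_memPn hc) addn0.
Qed.

Lemma block_interval s a l q c : is_block s a l q c -> interval_at s (size a).
Proof.
move=> h; rewrite /interval_at (block_size_block h) (drop_block h) /=.
by rewrite take_size_cat ?size_nseq.
Qed.

Lemma del_labels_block s a l q c : is_block s a l q c ->
  del_labels s (size a) q.+1 = a ++ c.
Proof.
case=> -> _; rewrite /del_labels take_size_cat //.
by rewrite catA drop_size_cat // size_cat size_nseq.
Qed.

Lemma block_size_lt s a l q c : is_block s a l q c -> (size a < size s)%N.
Proof. by case=> -> _; rewrite !size_cat size_nseq; lia. Qed.

Lemma interval_block s p : (p < size s)%N -> interval_at s p ->
  exists a l q c, is_block s a l q c /\ size a = p.
Proof.
move=> hp; rewrite /interval_at /block_size.
case E: (drop p s) => [|l d] //.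
have hl : l \in s by apply: (@mem_drop p); rewrite E mem_head.
move: hl; rewrite -has_pred1 has_count; case eq: (count_mem l s) => [//|q] _.
move/eqP => et.
exists (take p s), l, q, (drop q.+1 (drop p s)); rewrite size_take hp; split=> //.
have es : s = take p s ++ nseq q.+1 l ++ drop q.+1 (drop p s).
  by rewrite -et -E cat_take_drop cat_take_drop.
split=> //; move: eq; rewrite {1}es !count_cat count_nseq /= eqxx mul1n.
rewrite mem_cat -!has_pred1 !has_count; lia.
Qed.

Lemma find_interval_lt s : (find (interval_at s) (iota 0 (size s)) < size s)%N ->
  exists a l q c, [/\ is_block s a l q c, size a = find (interval_at s) (iota 0 (size s))
   & forall a' l' q' c', is_block s a' l' q' c' -> (size a <= size a')%N].
Proof.
set p := find _ _ => hp.
have hh : has (interval_at s) (iota 0 (size s)) by rewrite has_find size_iota.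
have := nth_find 0%N hh; rewrite -/p nth_iota // add0n => hi.
have [a [l [q [c [hb ea]]]]] := interval_block hp hi.
exists a, l, q, c; split=> // a' l' q' c' h'; rewrite ea leqNgt; apply/negP=> lt.
have := before_find 0%N lt; rewrite nth_iota ?add0n ?(block_size_lt h') //.
by rewrite (block_interval h').
Qed.

Lemma find_interval_ge s a l q c : (size s <= find (interval_at s) (iota 0 (size s)))%N ->
  ~ is_block s a l q c.
Proof.
move=> hge hb.
have: has (interval_at s) (iota 0 (size s)).
  apply/hasP; exists (size a); last exact: block_interval hb.
  by rewrite mem_iota (block_size_lt hb).
by rewrite has_find size_iota ltnNge hge.
Qed.

Lemma nonconstant_size s : ~~ constant s -> (1 < size s)%N.
Proof. by case: s => [|x [|y s]]. Qed.
End Blocks.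

Section Bracket.
Context {L : eqType} {K : pzRingType} {B M : algType K}.
Variables (inc : {lrmorphism B -> M}) (kappa : seq M -> B).
Implicit Types (s a c : seq L) (m u v w : seq M).

Lemma bracket_rec_fuel f f' s m : (size s <= f)%N -> (size s <= f')%N ->
  bracket_rec inc kappa f s m = bracket_rec inc kappa f' s m.
Proof.
elim: f f' s m => [|f IH] [|f'] s m; rewrite ?leqn0 ?size_eq0 //.
- by move=> /eqP->.
- by move=> _ /eqP->.
move=> h h' /=; case: ifP => // /negbT /nonconstant_size hs.
case: ifP => // hlt; have [a [l [q [c [hb ea _]]]]] := find_interval_lt hlt.
rewrite -ea (block_size_block hb) (del_labels_block hb).
have: (size (a ++ c) < size s)%N.
  by case: hb => -> _; rewrite !size_cat size_nseq; lia.
by move=> ?; apply: IH; lia.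
Qed.

Variant bracket_spec s m : B -> Prop :=
| BracketConst of constant s : bracket_spec s m (kappa m)
| BracketStep a l q c of ~~ constant s & is_block s a l q c
    & (forall a' l' q' c', is_block s a' l' q' c' -> (size a <= size a')%N) :
    bracket_spec s m (bracket inc kappa (a ++ c) (del_args inc kappa m (size a) q.+1))
| BracketStuck of ~~ constant s & (forall a l q c, ~ is_block s a l q c) :
    bracket_spec s m 0.

Lemma bracketP s m : bracket_spec s m (bracket inc kappa s m).
Proof.
rewrite /bracket; have: (size s <= size s)%N by [].
move: {2 3}(size s) => [|f] hf /=.
  by move: hf; rewrite leqn0 size_eq0 => /eqP ->; apply: BracketConst.
case: ifP => [|/negbT] hc; first exact: BracketConst.
case: ltnP => hlt; last first.
  by apply: BracketStuck => // a l q c; apply: find_interval_ge.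
have [a [l [q [c [hb ea hmin]]]]] := find_interval_lt hlt.
rewrite -ea (block_size_block hb) (del_labels_block hb).
rewrite (@bracket_rec_fuel _ (size (a ++ c))) //; first exact: BracketStep hb hmin.
by case: hb hf => -> _; rewrite !size_cat size_nseq; lia.
Qed.

Lemma bracket_const s m : constant s -> bracket inc kappa s m = kappa m.
Proof. by case: bracketP => // [a l q c|] /negbTE->. Qed.

Lemma bracket_step s a l q c m : ~~ constant s -> is_block s a l q c ->
  (forall a' l' q' c', is_block s a' l' q' c' -> (size a <= size a')%N) ->
  bracket inc kappa s m = bracket inc kappa (a ++ c) (del_args inc kappa m (size a) q.+1).
Proof.
move=> hs hb hmin; case: bracketP; first by rewrite (negbTE hs).
  move=> a' l' q' c' _ hb' hmin'.
  have e : size a = size a' by apply/eqP; rewrite eqn_leq (hmin _ _ _ _ hb') (hmin' _ _ _ _ hb).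
  have := block_size_block hb'; rewrite -e (block_size_block hb) => -[eq].
  by rewrite -(del_labels_block hb') -(del_labels_block hb) e eq.
by move=> _ /(_ a l q c).
Qed.

Lemma del_args_cat u v w p q : size u = p -> size v = q ->
  del_args inc kappa (u ++ v ++ w) p q = insert u (inc (kappa v)) w.
Proof.
move=> <- <-; rewrite /del_args take_size_cat // drop_size_cat // take_size_cat //.
by rewrite catA drop_size_cat // size_cat.
Qed.

Lemma bracket_stuck s m : ~~ constant s -> (forall a l q c, ~ is_block s a l q c) ->
  bracket inc kappa s m = 0.
Proof.
by move=> hs hb; case: bracketP => // [|a l q c _ /hb //]; rewrite (negbTE hs).
Qed.

Lemma insert_rcons u y x w : insert (rcons u y) x w = u ++ y * x :: w.
Proof. by elim: u => //= z u ->; case: u. Qed.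

Lemma size_insert u x w : size (insert u x w) = (size u + size w)%N.
Proof. by elim: u => [|y [|z u] IH] //=; [case: w | rewrite IH]. Qed.

Lemma insert_cat_cons u y u' x w :
  insert (u ++ y :: u') x w = u ++ insert (y :: u') x w.
Proof. by elim: u => // z [|t u] //= ->. Qed.

Lemma insert_cons_cat y u x w : insert (y :: u) x w = insert (y :: u) x [::] ++ w.
Proof. by case/lastP: u => [//|u z]; rewrite -rcons_cons !insert_rcons -catA. Qed.

Lemma split_block s a l q c m : is_block s a l q c -> size s = size m ->
  exists u v w, [/\ m = u ++ v ++ w, size u = size a, size v = q.+1 & size w = size c].
Proof.
case=> -> _; rewrite !size_cat size_nseq => e.
exists (take (size a) m), (take q.+1 (drop (size a) m)), (drop q.+1 (drop (size a) m)).
by rewrite !cat_take_drop !size_drop !size_take_min !size_drop; split=> //; lia.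
Qed.

Lemma block_nonconst s a l q c : ~~ constant s -> is_block s a l q c -> (0 < size a + size c)%N.
Proof.
move=> hs [es _]; rewrite addn_gt0 !lt0n !size_eq0 -negb_and; apply: contra hs.
by case/andP => /eqP a0 /eqP c0; rewrite es a0 c0 cats0; apply/(constantP l); exists l; rewrite size_nseq.
Qed.

Lemma block_size_cat s a l q c : is_block s a l q c -> size s = (size a + q.+1 + size c)%N.
Proof. by case=> -> _; rewrite !size_cat size_nseq addnA. Qed.

Hypotheses (kappa_lin : multilinear kappa) (kappa_bal : balanced inc kappa).

Lemma kappa_lin0 u v : kappa (u ++ 0 :: v) = 0.
Proof.
have := kappa_lin u v (-1) 0 0; rewrite scaler0 addr0 scaleN1r.
by rewrite addNr.
Qed.

(** If the removed block is at the front, [kappa] releases [b] on the left and the inserted value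
    carries it to the next argument; otherwise [b] stays at the first argument. Induct on the
    length. *)
Lemma bracket_mull s b x m : size s = (size m).+1 ->
  bracket inc kappa s (inc b * x :: m) = b * bracket inc kappa s (x :: m).
Proof.
case: kappa_bal => balL _ _.
elim: {s}_.+1 {-2}s (ltnSn (size s)) b x m => // N IH s hN b x m es.
case: bracketP => [hs|a l q c hs hb hmin|hs hb]; first by rewrite bracket_const.
  rewrite (bracket_step _ hs hb hmin).
  have [u [v [w [em eu ev ew]]]] := split_block (m := x :: m) hb es.
  have hsz := block_size_cat hb; have hnc := block_nonconst hs hb.
  case: u em eu => [|y u] /= em eu; move: ew ev em => ew ev em.
    case: v ev em => // y v ev [-> ->].
    rewrite -(cat0s (y :: v ++ w)) -(cat0s (_ :: v ++ w)) -!cat_cons !del_args_cat //=.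
    case: w ew => [|z w] /= ew; first by move: hnc; rewrite -eu -ew.
    by rewrite balL rmorphM -mulrA IH // size_cat; lia.
  case: em => -> ->; rewrite -!cat_cons !del_args_cat //.
  have hsz' z : size (a ++ c) = size (insert (z :: u) (inc (kappa v)) w).
    by rewrite size_insert size_cat /= eu ew.
  by case: u eu hsz' => [|z u] /= eu hsz'; rewrite -?mulrA IH //; try exact: (hsz' y); rewrite size_cat; lia.
by rewrite bracket_stuck // mulr0.
Qed.

Lemma bracket_linear s u v k x y : size s = (size u + size v).+1 ->
  bracket inc kappa s (u ++ (k *: x + y) :: v) =
  k *: bracket inc kappa s (u ++ x :: v) + bracket inc kappa s (u ++ y :: v).
Proof.
elim: {s}_.+1 {-2}s (ltnSn (size s)) u v k x y => // N IH s hN u v k x y es.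
case: bracketP => [hs|a l q c hs hb hmin|hs hb]; first by rewrite !bracket_const.
  rewrite !(bracket_step _ hs hb hmin).
  have hsz := block_size_cat hb; have hnc := block_nonconst hs hb.
  have lt : (size (a ++ c) < N)%N by rewrite size_cat; lia.
  (* The linear argument lies before, inside or after the removed block. If it is adjacent to the
     block, it also absorbs the inserted value, whence the subcases. *)
  case: (ltnP (size u) (size a)) => [lt1|ge1].
    pose t := take (size a - (size u).+1) v; pose r := drop (size a - (size u).+1) v.
    have ev : v = t ++ take q.+1 r ++ drop q.+1 r by rewrite !cat_take_drop.
    have ez z : u ++ z :: v = (u ++ z :: t) ++ take q.+1 r ++ drop q.+1 r.
      by rewrite -catA cat_cons -ev.
    have et : size t = (size a - (size u).+1)%N by rewrite size_take_min; lia.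
    have er : size r = (q.+1 + size c)%N by rewrite size_drop; lia.
    rewrite !ez !del_args_cat ?size_cat /= ?et ?size_take_min ?er; try lia.
    case/lastP: t et {ev ez} => [|t z] et.
      rewrite !cats1 !insert_rcons mulrDl -scalerAl IH //.
      by rewrite size_cat size_drop er; move: et => /=; lia.
    rewrite -!rcons_cons -!rcons_cat !insert_rcons -!catA !cat_cons IH //.
    rewrite size_rcons in et.
    by rewrite !size_cat /= size_drop er; lia.
  case: (ltnP (size u) (size a + q.+1)) => [lt2|ge2].
    pose u1 := take (size a) u; pose u2 := drop (size a) u.
    pose v1 := take (size a + q - size u) v; pose v2 := drop (size a + q - size u) v.
    have ez z : u ++ z :: v = u1 ++ (u2 ++ z :: v1) ++ v2.
      by rewrite -catA cat_cons cat_take_drop catA cat_take_drop.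
    have e1 : size u1 = size a by rewrite size_take_min; lia.
    have e2 : size v2 = size c by rewrite size_drop; lia.
    rewrite !ez !del_args_cat // ?size_cat /= ?size_take_min ?size_drop; try lia.
    rewrite kappa_lin linearP.
    case/lastP: u1 e1 {ez} => [|u1 z] e1; last first.
      rewrite !insert_rcons mulrDr -scalerAr IH // size_cat e2 -e1 size_rcons; lia.
    case: v2 e2 => [|z w] e2; first by move: hnc; rewrite -e1 -e2.
    rewrite /= mulrDl -scalerAl; apply: (IH _ _ [::]) => //.
    by rewrite size_cat -e1 -e2.
  pose u1 := take (size a) u; pose u2 := take q.+1 (drop (size a) u).
  pose u3 := drop q.+1 (drop (size a) u).
  have ez z : u ++ z :: v = u1 ++ u2 ++ u3 ++ z :: v.
    by rewrite 2!catA -(catA u1) !cat_take_drop.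
  have e1 : size u1 = size a by rewrite size_take_min; lia.
  have e2 : size u2 = q.+1 by rewrite size_take_min size_drop; lia.
  have e3 : size c = (size u3 + size v).+1 by rewrite !size_drop; lia.
  rewrite !ez !del_args_cat //.
  case/lastP: u1 e1 {ez} => [|u1 z] e1; last first.
    rewrite !insert_rcons -!cat_cons !catA IH // !size_cat /= e3 -e1 size_rcons; lia.
  case: u3 e3 => [|z u3] e3 /=; last first.
    by rewrite -!cat_cons IH // size_cat e3 -e1.
  rewrite mulrDr -scalerAr; apply: (IH _ _ [::]) => //.
  by rewrite size_cat e3 -e1.
by rewrite !bracket_stuck // scaler0 addr0.
Qed.

Lemma bracket_additive s u v x y : size s = (size u + size v).+1 ->
  bracket inc kappa s (u ++ (x + y) :: v) =
  bracket inc kappa s (u ++ x :: v) + bracket inc kappa s (u ++ y :: v).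
Proof. by move=> es; rewrite -[x]scale1r bracket_linear // !scale1r. Qed.

Lemma bracket_zero s u v : size s = (size u + size v).+1 ->
  bracket inc kappa s (u ++ 0 :: v) = 0.
Proof.
move=> es; have := bracket_linear (-1) 0 0 es.
by rewrite scaler0 addr0 scaleN1r addNr.
Qed.

Lemma bracket_sum s u v (I : Type) (r : seq I) (f : I -> M) :
  size s = (size u + size v).+1 ->
  bracket inc kappa s (u ++ \sum_(i <- r) f i :: v) =
  \sum_(i <- r) bracket inc kappa s (u ++ f i :: v).
Proof.
move=> es; elim: r => [|i r IH]; first by rewrite !big_nil bracket_zero.
by rewrite !big_cons bracket_additive // IH.
Qed.
End Bracket.

Section Relabel.
Context {L L' : eqType} {B M : pzRingType}.
Variables (inc : B -> M) (kappa : seq M -> B) (h : L -> L').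

Lemma constant_map_in s : {in s &, injective h} -> constant (map h s) = constant s.
Proof.
case: s => // x s hi /=; rewrite all_map; apply: eq_in_all => y ys /=.
by apply: (inj_in_eq hi); rewrite ?inE ?eqxx ?ys ?orbT.
Qed.

Lemma count_mem_map_in s l : {in s &, injective h} -> l \in s ->
  count_mem (h l) (map h s) = count_mem l s.
Proof.
by move=> hi ls; rewrite count_map; apply: eq_in_count => y ys /=; apply: (inj_in_eq hi).
Qed.

Lemma block_size_map_in s p : {in s &, injective h} ->
  block_size (map h s) p = block_size s p.
Proof.
move=> hi; rewrite /block_size -map_drop; case E: (drop p s) => [//|l d] /=.
by apply: count_mem_map_in => //; apply: (@mem_drop p); rewrite E mem_head.
Qed.

Lemma interval_at_map_in s p : {in s &, injective h} ->
  interval_at (map h s) p = interval_at s p.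
Proof.
move=> hi; rewrite /interval_at block_size_map_in // -map_drop.
case E: (drop p s) => [//|l d].
change ((take (block_size s p) (map h (l :: d)) == nseq (block_size s p) (h l)) =
  (take (block_size s p) (l :: d) == nseq (block_size s p) l)).
have hd y : y \in l :: d -> y \in s by rewrite -E; apply: mem_drop.
rewrite -map_take -(map_nseq _ h); have ls : l \in s by rewrite hd ?mem_head.
have ht : all [in s] (take (block_size s p) (l :: d)).
  by apply/allP => y /mem_take/hd.
have hn : all [in s] (nseq (block_size s p) l) by rewrite all_nseq /= ls orbT.
by rewrite (inj_in_eq (inj_in_map hi)).
Qed.

Lemma bracket_rec_map_in f s (m : seq M) : {in s &, injective h} ->
  bracket_rec inc kappa f (map h s) m = bracket_rec inc kappa f s m.
Proof.
elim: f s m => [|f IH] s m hi /=; rewrite constant_map_in // size_map.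
case: ifP => // _.
rewrite (eq_find (a2 := interval_at s)); last by move=> p; apply: interval_at_map_in.
case: ifP => // _; rewrite block_size_map_in // /del_labels -map_drop -map_take -map_cat.
rewrite IH // => x y; rewrite !mem_cat => hx hy; apply: hi.
  by case/orP: hx => [/mem_take|/mem_drop].
by case/orP: hy => [/mem_take|/mem_drop].
Qed.

(** Labels are only compared with each other. This allows blocks, as sets, to be replaced by
    numbers, and numbers to be shifted. *)
Lemma bracket_map_in s (m : seq M) : {in s &, injective h} ->
  bracket inc kappa (map h s) m = bracket inc kappa s m.
Proof. by move=> hi; rewrite /bracket bracket_rec_map_in ?size_map. Qed.
End Relabel.

Section BlockCat.
Context {L : eqType}.
Implicit Types (X Y Z a c : seq L) (l : L).

Lemma block_prefix X Y a l q c : X ++ Y = a ++ nseq q.+1 l ++ c -> l \notin X ->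
  exists2 g, a = X ++ g & Y = g ++ nseq q.+1 l ++ c.
Proof.
elim: X a => [|x X IH] [|y a] /=; [by exists [::]|by exists (y :: a)| |].
  by case=> ->; rewrite mem_head.
case=> -> /IH h; rewrite inE negb_or => /andP[_ /h[g -> eY]].
by exists g.
Qed.

Lemma block_suffix Y Z a l q c : Y ++ Z = a ++ nseq q.+1 l ++ c -> l \notin Z ->
  exists2 g, c = g ++ Z & Y = a ++ nseq q.+1 l ++ g.
Proof.
elim/last_ind: Z c => [|Z z IH] c; first by rewrite cats0 => -> _; exists c; rewrite ?cats0.
rewrite mem_rcons inE negb_or -rcons_cat.
case/lastP: c => [|c y].
  have nr n : nseq n.+1 l = rcons (nseq n l) l by elim: n => //= n ->.
  by rewrite cats0 nr -rcons_cat => /rcons_inj [_ ->]; rewrite eqxx.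
move=> h /andP[nl nZ]; move: h; rewrite -!rcons_cat => /rcons_inj [/IH h ->].
by have [g -> eY] := h nZ; exists g; rewrite ?rcons_cat.
Qed.

Lemma block_middle X Y Z a l q c : X ++ Y ++ Z = a ++ nseq q.+1 l ++ c ->
  l \notin X -> l \notin Z ->
  exists g g', [/\ a = X ++ g, c = g' ++ Z & Y = g ++ nseq q.+1 l ++ g'].
Proof.
move=> e /(block_prefix e)[g -> /block_suffix h] /h[g' -> ->].
by exists g, g'.
Qed.
End BlockCat.

(** * Bracketing a gap of a block separately *)

Section BracketInterval.
Context {L : eqType} {K : pzRingType} {B M : algType K}.
Variables (inc : {lrmorphism B -> M}) (kappa : seq M -> B).
Hypotheses (kappa_lin : multilinear kappa) (kappa_bal : balanced inc kappa).
Implicit Types (s a c g : seq L) (m u v w : seq M).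

Lemma split_size m p q : size m = (p + q)%N ->
  exists u v, [/\ m = u ++ v, size u = p & size v = q].
Proof.
move=> e; exists (take p m), (drop p m).
by rewrite cat_take_drop size_take_min size_drop; split=> //; lia.
Qed.

Lemma last_nseq n (l : L) : last l (nseq n l) = l.
Proof. by elim: n. Qed.

Lemma not_constant s x y : x \in s -> y \in s -> x != y -> ~~ constant s.
Proof.
move=> xs ys ne; apply: contra ne => /(constantP x)[z es]; move: xs ys.
by rewrite es !mem_nseq => /andP[_ /eqP->] /andP[_ /eqP->].
Qed.

(** [g] labels a gap between two positions of the block [z], or after its last one when [k] is 0;
    [last z a = z] says that the position just before the gap is in that block. The induction
    follows the leftmost interval block, which is in [g], is the block [z] itself, or lies inside
    [a]. *)
Lemma bracket_interval z a g k u x v w :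
  last z a = z -> (0 < size g)%N -> (forall l, l \in g -> l \notin z :: a) ->
  size u = size a -> size v = size g -> size w = k ->
  bracket inc kappa ((z :: a) ++ g ++ nseq k z) (u ++ x :: v ++ w) =
  bracket inc kappa ((z :: a) ++ nseq k z) (u ++ x * inc (bracket inc kappa g v) :: w).
Proof.
have [n] := ubnP (size a + size g); elim: n => // n IH in a g u x v w *.
move=> hn lz g0 hd eu ev ew.
have [y yg] : exists y, y \in g by case: (g) g0 => // y g' _; exists y; rewrite mem_head.
have nyz : z != y by apply/eqP => e; move: (hd _ yg); rewrite -e mem_head.
have hdz l : l \in g -> l \notin nseq k z.
  move=> lg; rewrite mem_nseq negb_and; apply/orP; right.
  by apply/eqP => e; move: (hd _ lg); rewrite e mem_head.
set s := (z :: a) ++ g ++ nseq k z.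
have sz : size s = (size a + size g + k).+1.
  by rewrite /s !size_cat size_nseq /= !addSn addnA.
have ncs : ~~ constant s.
  by apply: (@not_constant _ z y) => //; rewrite !mem_cat ?mem_head ?yg ?orbT.
have szR : size ((z :: a) ++ nseq k z) = (size u + size w).+1.
  by rewrite size_cat size_nseq /= eu ew.
case: bracketP => [cs|a1 l q c1 _ hb hmin|_ nb]; first by rewrite cs in ncs.
- have [es nl] := hb; move: nl; rewrite mem_cat negb_or => /andP[nla nlc].
  have lbl : l \in nseq q.+1 l by rewrite mem_nseq eqxx.
  have [lg|nlg] := boolP (l \in g).
    have [g1 [g2 [ea ec eg]]] := block_middle es (hd _ lg) (hdz _ lg).
    have szg : size g = (size g1 + (q.+1 + size g2))%N by rewrite eg !size_cat size_nseq.
    have [v1 [v' [e1 e2 e3]]] := split_size (etrans ev szg).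
    have [vb [v2 [e4 e5 e6]]] := split_size e3.
    have -> : u ++ x :: v ++ w = (rcons u x ++ v1) ++ vb ++ (v2 ++ w).
      by rewrite e1 e4 -!catA cat_rcons.
    rewrite del_args_cat //; last by rewrite ea !size_cat size_rcons eu e2.
    have nlg12 : l \notin g1 ++ g2.
      by move: nla nlc; rewrite ea ec !mem_cat !negb_or => /andP[_ ->] /andP[-> _].
    have hbg : is_block g g1 l q g2 by split.
    have hming a' l' q' c' : is_block g a' l' q' c' -> (size g1 <= size a')%N.
      move=> [eg' nl']; have hl' : l' \in g by rewrite eg' !mem_cat mem_nseq eqxx orbT.
      have : is_block s ((z :: a) ++ a') l' q' (c' ++ nseq k z).
        split; first by rewrite /s eg' -!catA.
        move: nl' (hd _ hl') (hdz _ hl'); rewrite !mem_cat !negb_or.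
        by case/andP => -> -> -> ->.
      by move/hmin; rewrite ea !size_cat leq_add2l.
    have [c12|] := posnP (size (g1 ++ g2)).
      move/size0nil: c12; case: (g1) (g2) e2 e6 e1 e4 ea ec eg => [|//] [|//] /= /size0nil -> /size0nil -> -> -> -> ->.
      rewrite /= !cats0 insert_rcons => eg.
      by rewrite eg [bracket inc kappa (l :: _) _]bracket_const //; apply: (constant_nseq q.+1).
    move=> pos.
    have hdg l' : l' \in g1 ++ g2 -> l' \notin z :: a.
      by move=> h; apply: hd; rewrite eg !mem_cat; move: h; rewrite mem_cat => /orP[]->; rewrite ?orbT.
    have ncg : ~~ constant g.
      have [l' h'] : exists l', l' \in g1 ++ g2.
        by case: (g1 ++ g2) pos => // l' r _; exists l'; rewrite mem_head.
      apply: (@not_constant _ l l') => //.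
        by rewrite eg !mem_cat; move: h'; rewrite mem_cat => /orP[]->; rewrite ?orbT.
      by apply: contra nlg12 => /eqP ->.
    rewrite (bracket_step _ _ _ ncg hbg hming) e1 e4 del_args_cat //.
    have lt12 : (size a + size (g1 ++ g2) < n)%N by move: hn; rewrite szg size_cat; lia.
    have -> : a1 ++ c1 = (z :: a) ++ (g1 ++ g2) ++ nseq k z by rewrite ea ec -!catA.
    (* If the removed block opens the gap, its value multiplies [x] from the right in the full
       bracket, but the next argument of the gap from the left in the separate one; [bracket_mull]
       reconciles the two. *)
    case: v1 e1 e2 => [|y1 v1] e1 e2.
      case: v2 e4 e6 => [|y2 v2] e4 e6; first by move: pos; rewrite size_cat -e2 -e6.
      rewrite cats0 insert_rcons IH //= ?size_cat -?e2 -?e6 //.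
      by rewrite bracket_mull ?size_cat -?e2 -?e6 // rmorphM mulrA.
    have -> : insert (rcons u x ++ y1 :: v1) (inc (kappa vb)) (v2 ++ w) =
        u ++ x :: insert (y1 :: v1) (inc (kappa vb)) v2 ++ w.
      rewrite insert_cat_cons cat_rcons; congr (_ ++ _ :: _).
      by rewrite insert_cons_cat catA -insert_cons_cat.
    by rewrite IH // size_insert e2 e6 size_cat.
  (* The block [z] is an interval here only if nothing follows the gap: for [k > 0] it would reach
     from the first to the last position. For [k = 0] its value multiplies the gap from the left,
     which is right balancing of [kappa] on the other side. *)
  have [elz|nlz] := eqVneq l z.
    case: a1 nla es {hb hmin} => [|z1 a1] nla es; last first.
      by case: es nla => e _; rewrite -e elz mem_head.
    rewrite elz in es nlc *.
    have [k0|kp] := posnP k.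
      have nzg : z \notin g by apply/negP => /hd; rewrite mem_head.
      rewrite /s k0 cats0 in es; rewrite k0 in ew *.
      have [g' ec ea] := block_suffix es nzg.
      have g'0 : g' = [::].
        case/lastP: g' ec ea => // g' z' ec ea; case/negP: nlc.
        have := congr1 (last z) ea; rewrite last_cons lz !last_cat last_rcons => ->.
        by rewrite ec mem_cat mem_rcons mem_head.
      rewrite g'0 /= in ec; rewrite g'0 cats0 in ea; rewrite ec ![_ ++ nseq 0 z]cats0 ea.
      rewrite (size0nil ew) cats0 (bracket_const _ _ _ (constant_nseq _ _)).
      have -> : u ++ x :: v = [::] ++ rcons u x ++ v by rewrite cat_rcons.
      rewrite del_args_cat //; last first.
        by rewrite size_rcons eu; move/(congr1 size): ea; rewrite /= size_nseq.
      case: v ev => [|y1 v] ev; first by rewrite -ev in g0.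
      rewrite /= bracket_mull //.
      by case: kappa_bal => _ balR _; rewrite cats1 balR.
    have lasts : last z s = z.
      by rewrite /s !last_cat /= lz; case: (k) kp => //= k' _; rewrite last_nseq.
    case/lastP: c1 nlc es => [|c1 z'] nlc es; last first.
      by rewrite es !last_cat last_rcons in lasts; rewrite mem_rcons inE lasts eqxx in nlc.
    by case/negP: ncs; rewrite es cats0 (constant_nseq q.+1).
  (* The block now lies in [a], before the final [z]. It is also the leftmost interval block once
     the gap is deleted, so both sides make the same step. *)
  have nlk : l \notin nseq k z by rewrite mem_nseq negb_and nlz orbT.
  have nlgk : l \notin g ++ nseq k z by rewrite mem_cat negb_or nlg.
  have [a2 ec ea] := block_suffix es nlgk.
  case: a1 ea es hb nla hmin => [|z1 a1] ea es hb nla hmin; first by case: ea nlz => ->; rewrite eqxx.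
  case: ea hb hmin es nla => <- ea hb hmin es nla.
  case/lastP: a2 ec ea => [|a2 z2] ec ea.
    by move: lz nlz; rewrite ea cats0 last_cat /= last_nseq => ->; rewrite eqxx.
  have ez2 : z2 = z by move: lz; rewrite ea !(last_cat, last_cons) last_rcons.
  rewrite {}ez2 in ec ea.
  have esz : size (rcons u x) = (size (z :: a1) + (q.+1 + (size a2).+1))%N.
    by rewrite size_rcons eu ea !size_cat /= size_cat size_nseq size_rcons; lia.
  have [u1 [u' [e1 e2 e3]]] := split_size esz.
  have [ub [u2 [e4 e5 e6]]] := split_size e3.
  case/lastP: u2 e4 e6 => [|u2 x'] e4 e6; first by [].
  have [eu' ex] : u = u1 ++ ub ++ u2 /\ x' = x.
    by move: e1; rewrite e4 -!rcons_cat => /rcons_inj[].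
  rewrite {}ex in e4 e6; move: e6; rewrite size_rcons => -[e6].
  have la : l \in z :: a by rewrite ea inE !mem_cat mem_head !orbT.
  pose s' := (z :: a) ++ nseq k z.
  have hb' : is_block s' (z :: a1) l q (rcons a2 z ++ nseq k z).
    split; first by rewrite /s' ea /= -!catA /= -!catA.
    move: nla nlc; rewrite ec !mem_cat !negb_or => -> /andP[-> _] /=.
    exact: nlk.
  have ncs' : ~~ constant s'.
    by apply: (@not_constant _ l z) => //; rewrite mem_cat ?la ?mem_head.
  have hmin' a' l' q' c' : is_block s' a' l' q' c' -> (size (z :: a1) <= size a')%N.
    have [->|nlz'] := eqVneq l' z; move=> [es' nl'].
      case: a' es' nl' => [|z' a'] es' nl'; last first.
        by case: es' nl' => <-; rewrite cat_cons mem_head.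
      have lasts : last z s' = z.
        by rewrite /s' last_cat /= lz; case: (k) => //= k' ; rewrite last_nseq.
      case/lastP: c' es' nl' => [|c' z'] es' nl'.
        by case/negP: ncs'; rewrite es' cats0 (constant_nseq q'.+1).
      by rewrite es' !last_cat last_rcons in lasts; rewrite lasts mem_rcons mem_head in nl'.
    have nlk' : l' \notin nseq k z by rewrite mem_nseq negb_and nlz' orbT.
    have [r' ec' ea'] := block_suffix es' nlk'.
    apply: (hmin _ l' q' (r' ++ g ++ nseq k z)); split; first by rewrite /s ea' -!catA.
    have nlg' : l' \notin g.
      by apply: contraL nlk' => /hd; rewrite ea' !mem_cat mem_nseq eqxx /= orbT.
    move: nl'; rewrite ec' !mem_cat !negb_or nlk' (negbTE nlg') andbT.
    by case/andP => -> ->.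
  rewrite (bracket_step _ _ _ ncs' hb' hmin').
  have -> : u ++ x :: v ++ w = u1 ++ ub ++ (rcons u2 x ++ v ++ w).
    by rewrite eu' -!catA cat_rcons.
  have -> y0 : u ++ y0 :: w = u1 ++ ub ++ (rcons u2 y0 ++ w).
    by rewrite eu' -!catA cat_rcons.
  rewrite !del_args_cat //.
  case: u1 e1 e2 eu' => [|y1 u1] // e1 e2 eu'.
  rewrite [in LHS]insert_cons_cat [in RHS]insert_cons_cat.
  have szi := size_insert (y1 :: u1) (inc (kappa ub)) [::].
  move: (insert _ _ _) szi => ins szi.
  rewrite !cat_rcons !(catA ins) ec.
  have -> : (z :: a1) ++ rcons a2 z ++ g ++ nseq k z =
      (z :: a1 ++ rcons a2 z) ++ g ++ nseq k z by rewrite /= -!catA.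
  have -> : (z :: a1) ++ a2 ++ z :: nseq k z =
      (z :: a1 ++ rcons a2 z) ++ nseq k z by rewrite /= -catA cat_rcons.
  apply: IH => //.
  - by move: hn; rewrite ea !size_cat /= size_cat; lia.
  - by rewrite last_cat last_rcons.
  - move=> l0 /hd; apply: contra; rewrite ea !inE !mem_cat !inE !mem_cat.
    by case/or3P => ->; rewrite ?orbT.
  - by rewrite !size_cat szi e6 size_rcons e2 /= addn0 addSnnS.
(* Without an interval block in the whole sequence there is none in the gap either; both brackets
   then take the default value 0. *)
- have ncg : ~~ constant g.
    apply/negP => /(constantP z)[l eg]; case: (size g) eg g0 => // p eg _.
    have lg : l \in g by rewrite eg mem_head.
    apply: (nb (z :: a) l p (nseq k z)); split; first by rewrite /s eg.
    by rewrite mem_cat negb_or hd ?hdz.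
  rewrite (bracket_stuck _ _ _ ncg); last first.
    move=> a' l' q' c' [eg' nl']; have hl' : l' \in g by rewrite eg' !mem_cat mem_nseq eqxx orbT.
    apply: (nb ((z :: a) ++ a') l' q' (c' ++ nseq k z)).
    split; first by rewrite /s eg' -!catA.
    move: nl' (hd _ hl') (hdz _ hl'); rewrite !mem_cat !negb_or.
    by case/andP => -> -> -> ->.
  by rewrite rmorph0 mulr0 bracket_zero.
Qed.
End BracketInterval.

Local Close Scope ring_scope.

(** * Non-crossing partitions as sequences of labels *)

Definition first_labels (T : eqType) (s : seq T) := [seq index x s | x <- s].

(* Each block is labelled with its first position; for such labels the last
   condition expresses that the partition is non-crossing. *)
Definition nc_labelling (t : seq nat) :=
  forall i, i < size t ->
    [/\ nth 0 t i <= i, nth 0 t (nth 0 t i) = nth 0 t i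
      & forall j, nth 0 t i <= j <= i -> nth 0 t i <= nth 0 t j].

Lemma size_first_labels (T : eqType) (s : seq T) : size (first_labels s) = size s.
Proof. exact: size_map. Qed.

Lemma nth_first_labels (T : eqType) (x0 : T) s i : i < size s ->
  nth 0 (first_labels s) i = index (nth x0 s i) s.
Proof. by move=> hi; rewrite (nth_map x0). Qed.

(** If some [j] between the first position [k] of the block of [i] and [i] itself had a smaller
    label, then this label, [k], [j] and [i] would be a crossing. *)
Lemma first_labels_nc (T : eqType) (x0 : T) s :
  (forall a b c d, a < b -> b < c -> c < d -> d < size s ->
     nth x0 s a = nth x0 s c -> nth x0 s b = nth x0 s d -> nth x0 s a = nth x0 s b) ->
  nc_labelling (first_labels s).
Proof.
move=> nc i; rewrite size_first_labels => hi.
have hx : nth x0 s i \in s by apply: mem_nth.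
have hle := index_nth x0 hi.
have hlt : index (nth x0 s i) s < size s by rewrite index_mem.
rewrite !(nth_first_labels x0) //; split=> //; first by rewrite nth_index.
move=> j /andP[h1 h2]; have hj : j < size s by lia.
rewrite (nth_first_labels x0) // leqNgt; apply/negP => h3.
have hj' : nth x0 s j \in s by apply: mem_nth.
have e1 : nth x0 s (index (nth x0 s j) s) = nth x0 s j by rewrite nth_index.
have e2 : nth x0 s (index (nth x0 s i) s) = nth x0 s i by rewrite nth_index.
have [ej|nj] := eqVneq (nth x0 s j) (nth x0 s i); first by rewrite ej ltnn in h3.
have ji : j < i by rewrite ltn_neqAle h2 andbT; apply: contraNneq nj => ->.
have kj : index (nth x0 s i) s < j.
  by rewrite ltn_neqAle h1 andbT; apply: contraNneq nj => <-; rewrite e2.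
by case/eqP: nj; rewrite -e1 -[RHS]e2; apply: nc h3 kj ji hi e1 e2.
Qed.

Section PartitionLabels.
Variable n : nat.
Implicit Types P Q : {set {set 'I_n}}.

Definition block_labels P := [seq pblock P i | i <- enum 'I_n].

Lemma size_block_labels P : size (block_labels P) = n.
Proof. by rewrite size_map size_enum_ord. Qed.

Lemma nth_block_labels P (i : 'I_n) : nth set0 (block_labels P) i = pblock P i.
Proof. by rewrite (nth_map i) ?size_enum_ord // nth_ord_enum. Qed.

Lemma NC_first_labels P : P \in NC n -> nc_labelling (first_labels (block_labels P)).
Proof.
rewrite inE => /andP[/and3P[/eqP cP tP _] /forall_inP nc].
apply: (@first_labels_nc _ set0) => a b c d ab bc cd; rewrite size_block_labels => dn.
have cn : c < n by lia. have bn : b < n by lia. have an : a < n by lia.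
pose A := Ordinal an; pose b' := Ordinal bn; pose c' := Ordinal cn; pose d' := Ordinal dn.
rewrite (nth_block_labels P A) (nth_block_labels P b').
rewrite (nth_block_labels P c') (nth_block_labels P d') => ac bd.
have mP x : x \in pblock P x by rewrite mem_pblock cP inE.
have bP x : pblock P x \in P by rewrite pblock_mem // cP inE.
have /forall_inP/(_ (pblock P b') (bP _)) := nc _ (bP A).
move/implyP=> h; apply/eqP; apply: h.
apply/exists_inP; exists A => //; apply/exists_inP; exists b' => //.
apply/exists_inP; exists c'; first by rewrite ac.
apply/exists_inP; exists d'; first by rewrite bd.
by rewrite /= ab bc cd.
Qed.

Lemma first_labels_inj P Q : P \in NC n -> Q \in NC n ->
  first_labels (block_labels P) = first_labels (block_labels Q) -> P = Q.
Proof.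
rewrite !inE => /andP[pP _] /andP[pQ _] e.
rewrite -(preim_partition_pblock pP) -(preim_partition_pblock pQ).
have key R (i j : 'I_n) : (pblock R i == pblock R j) =
    (nth 0 (first_labels (block_labels R)) i == nth 0 (first_labels (block_labels R)) j).
  rewrite !(nth_first_labels set0) ?size_block_labels // !nth_block_labels.
  by rewrite (inj_in_eq (@index_inj _ set0 _)) // map_f ?mem_enum.
apply: eq_in_imset => x _; apply/setP => y; rewrite !inE /=.
by rewrite key e -key.
Qed.

(** The blocks are the fibres of the labelling. For [i < j < k < l] with [i], [k] and [j], [l]
    equally labelled, the last condition at [k] and at [l] bounds each of the two labels by the
    other. *)
Lemma nc_labelling_NC t : size t = n -> nc_labelling t ->
  exists2 P, P \in NC n & first_labels (block_labels P) = t.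
Proof.
move=> st ct; pose f (i : 'I_n) := nth 0 t i.
pose P := preim_partition f [set: 'I_n].
have pP : partition P [set: 'I_n] by apply: preim_partitionP.
have [/eqP cP tP _] := and3P pP.
have pbE (i j : 'I_n) : (pblock P i == pblock P j) = (f i == f j).
  rewrite eq_pblock ?cP ?inE // pblock_equivalence_partition ?inE //.
  by split=> // /eqP->.
exists P.
  rewrite inE pP; apply/forall_inP => V hV; apply/forall_inP => W hW.
  apply/implyP; case/exists_inP => i iV /exists_inP[j jW] /exists_inP[k kV].
  case/exists_inP => l lW /and3P[ij jk kl].
  rewrite -(def_pblock tP hV iV) -(def_pblock tP hW jW) pbE.
  have /eqP : f i == f k by rewrite -pbE (def_pblock tP hV iV) (def_pblock tP hV kV).
  have /eqP : f j == f l by rewrite -pbE (def_pblock tP hW jW) (def_pblock tP hW lW).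
  rewrite /f => jl ik.
  have hs (x : 'I_n) : x < size t by rewrite st.
  have [i1 i2 i3] := ct k (hs k); have [j1 j2 j3] := ct l (hs l).
  have [i1' _ _] := ct i (hs i); have [j1' _ _] := ct j (hs j).
  have h1 : nth 0 t k <= nth 0 t j by apply: i3; rewrite -ik; lia.
  have h2 : nth 0 t l <= nth 0 t k by apply: j3; rewrite -jl; lia.
  by apply/eqP; lia.
apply: (@eq_from_nth _ 0); rewrite size_first_labels size_block_labels // => i hi.
have hit : i < size t by rewrite st.
rewrite (nth_first_labels set0) ?size_block_labels //.
pose i' := Ordinal hi; rewrite (nth_block_labels P i').
have [h1 h2 h3] := ct i hit.
have hk : nth 0 t i < n by lia.
pose k' := Ordinal hk.
have ek : pblock P k' = pblock P i' by apply/eqP; rewrite pbE /f /= h2.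
apply/eqP; rewrite eqn_leq; apply/andP; split.
  rewrite -ek -(nth_block_labels P k') index_nth // size_block_labels //.
have hin : pblock P i' \in block_labels P by rewrite map_f ?mem_enum.
have hix : index (pblock P i') (block_labels P) < n by rewrite -index_mem size_block_labels in hin.
have := nth_index set0 hin; rewrite (nth_block_labels P (Ordinal hix)) => /eqP.
rewrite pbE /f /= => /eqP <-.
by have [] := ct (index (pblock P i') (block_labels P)); rewrite ?st.
Qed.
End PartitionLabels.

(** The appended 0 joins the position [size t] to the block of the first position, and is the first
    position itself when [t] is empty. The shift turns the labels of [g] into positions of the glued
    sequence. *)
Definition glue_labels (t g : seq nat) := rcons t 0 ++ map (addn (size t).+1) g.

(* Catalan recursion: [size t] is the last position in the block of [0]. *)
Fixpoint nc_labels_rec f n : seq (seq nat) :=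
  if n is n'.+1 then
    if f is f'.+1 then
      [seq s | j <- iota 0 n'.+1,
               s <- [seq glue_labels t g | t <- nc_labels_rec f' j,
                                           g <- nc_labels_rec f' (n' - j)]]
    else [::]
  else [:: [::]].

Definition nc_labels n := nc_labels_rec n n.

Lemma nc_labels_rec_fuel f f' n : n <= f -> n <= f' ->
  nc_labels_rec f n = nc_labels_rec f' n.
Proof.
elim: f f' n => [|f IH] [|f'] [|n] // hf hf'.
congr flatten; apply/eq_in_map => j; rewrite mem_iota => hj; congr (map _ _).
by rewrite -/nc_labels_rec (IH f' j) ?(IH f' (n - j)) //; lia.
Qed.

Lemma nc_labelsS n : nc_labels n.+1 =
  [seq s | j <- iota 0 n.+1,
           s <- [seq glue_labels t g | t <- nc_labels j, g <- nc_labels (n - j)]].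
Proof.
congr flatten; apply/eq_in_map => j; rewrite mem_iota => hj; congr (map _ _).
by rewrite -/nc_labels_rec /nc_labels (@nc_labels_rec_fuel _ j j) ?(@nc_labels_rec_fuel _ (n - j) (n - j)) //; lia.
Qed.

Lemma size_glue t g : size (glue_labels t g) = (size t + size g).+1.
Proof. by rewrite size_cat size_rcons size_map. Qed.

Lemma nth_glue t g i : nth 0 (glue_labels t g) i =
  if i < size t then nth 0 t i else
  if i == size t then 0 else
  if i < (size t + size g).+1 then (size t).+1 + nth 0 g (i - (size t).+1) else 0.
Proof.
rewrite nth_cat size_rcons nth_rcons ltnS.
case: (ltngtP i (size t)) => // gt; case: ltnP => h.
  by rewrite (nth_map 0) //; lia.
by rewrite nth_default // size_map; lia.
Qed.

Lemma nc_labelling_head t : nc_labelling t -> nth 0 t 0 = 0.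
Proof. by case: t => // x t /(_ 0 isT)[]; rewrite /= leqn0 => /eqP. Qed.

Lemma nc_labelling_glue t g :
  nc_labelling t -> nc_labelling g -> nc_labelling (glue_labels t g).
Proof.
move=> ht hg i; rewrite size_glue => hi; rewrite !nth_glue hi.
have t0 := nc_labelling_head ht.
have [lt|gt|->] := ltngtP i (size t).
- have [h1 h2 h3] := ht i lt; rewrite (leq_ltn_trans h1 lt); split=> // j hj.
  have jlt : j < size t by lia.
  by rewrite nth_glue jlt h3.
- have hi' : i - (size t).+1 < size g by lia.
  have [h1 h2 h3] := hg _ hi'; set x := nth 0 g _ in h1 h2 h3 *.
  have -> : ((size t).+1 + x < size t) = false by lia.
  have -> : ((size t).+1 + x == size t) = false by lia.
  have -> : ((size t).+1 + x < (size t + size g).+1) = true by lia.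
  rewrite addKn h2; split=> // [|j hj]; first by lia.
  rewrite nth_glue.
  have -> : (j < size t) = false by lia.
  have -> : (j == size t) = false by lia.
  have -> : (j < (size t + size g).+1) = true by lia.
  by rewrite leq_add2l h3 //; lia.
- split=> //; case: posnP => [/size0nil->|tp] //.
Qed.

Lemma nc_labelling_split s : 0 < size s -> nc_labelling s ->
  exists t g, [/\ nc_labelling t, nc_labelling g & s = glue_labels t g].
Proof.
move=> s0 hs; have h0 := nc_labelling_head hs.
have ex0 : exists i, (i < size s) && (nth 0 s i == 0) by exists 0; rewrite s0 h0.
have ub i : (i < size s) && (nth 0 s i == 0) -> i <= size s by case/andP=> /ltnW.
case: (ex_maxnP ex0 ub) => j /andP[js /eqP j0] hmax.
pose t := take j s; pose g := map (subn^~ j.+1) (drop j.+1 s).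
have st : size t = j by rewrite size_takel // ltnW.
have sg : size g = size s - j.+1 by rewrite size_map size_drop.
(* A label at most [j] to the right of [j] would be at most the label of [j], hence 0, against the
   choice of [j] as the last zero. *)
have big i : j < i -> i < size s -> j < nth 0 s i.
  move=> ji is'; have [h1 h2 h3] := hs i is'; rewrite ltnNge; apply/negP => le.
  have := h3 j; rewrite j0 le (ltnW ji) leqn0 => /(_ isT) /eqP e.
  by have := hmax i; rewrite is' e eqxx => /(_ isT); lia.
have nt i : i < j -> nth 0 t i = nth 0 s i by move=> h; rewrite nth_take.
have ng i : i < size g -> nth 0 g i = nth 0 s (j.+1 + i) - j.+1.
  by move=> h; rewrite (nth_map 0) ?nth_drop // size_drop -sg.
exists t, g; split.
- move=> i; rewrite st => ij; have [h1 h2 h3] := hs i (ltn_trans ij js).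
  rewrite !nt //; last by lia.
  by split=> // k hk; rewrite nt ?h3 //; lia.
- move=> i ig; have hi : j.+1 + i < size s by lia.
  have [h1 h2 h3] := hs _ hi; have b := big (j.+1 + i) ltac:(lia) hi.
  rewrite ng //; set x := nth 0 s _ in h1 h2 h3 b *.
  have xg : x - j.+1 < size g by lia.
  rewrite ng //; have -> : j.+1 + (x - j.+1) = x by lia.
  rewrite h2; split=> // [|k hk]; first by lia.
  have kg : k < size g by lia.
  by rewrite ng // leq_sub2r // h3; lia.
- apply: (@eq_from_nth _ 0); first by rewrite size_glue st sg; lia.
  move=> i hi; rewrite nth_glue st; case: ltngtP => [lt|gt|->//]; first by rewrite nt.
  have -> : (i < (j + size g).+1) = true by lia.
  rewrite ng; last by lia.
  have -> : j.+1 + (i - j.+1) = i by lia.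
  by have := big i gt hi; lia.
Qed.

Lemma glue_size_inj t g t' g' : glue_labels t g = glue_labels t' g' -> size t = size t'.
Proof.
wlog le : t g t' g' / size t <= size t'.
  by move=> h e; case: (leqP (size t) (size t')) => [|/ltnW] hl; [apply: h e | apply/esym/(h _ _ _ _ hl (esym e))].
move=> e; have es := congr1 size e; rewrite !size_glue in es.
have := congr1 (fun s => nth 0 s (size t')) e; rewrite /= !nth_glue ltnn eqxx.
by case: ltngtP le => // h _; case: ifP => //; lia.
Qed.

Lemma mem_nc_labels n t : t \in nc_labels n <-> size t = n /\ nc_labelling t.
Proof.
have [N] := ubnP n; elim: N n t => // N IH [|n] t hn.
  by rewrite inE; split=> [/eqP->|[/size0nil-> _]].
rewrite nc_labelsS; split.
  case/allpairsPdep => j [s [hj /allpairsP[[a b] /= [ha hb ->]] ->]].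
  rewrite mem_iota in hj.
  have [sa ca] := (IH j a ltac:(lia)).1 ha; have [sb cb] := (IH (n - j) b ltac:(lia)).1 hb.
  split; last exact: nc_labelling_glue.
  by rewrite size_glue sa sb subnKC //; lia.
case=> st ct; have [|a [b [ca cb et]]] := nc_labelling_split _ ct; first by rewrite st.
have e : (size a + size b)%N = n by apply: succn_inj; rewrite -st et size_glue.
apply/allpairsPdep; exists (size a), t; split=> //; first by rewrite mem_iota; lia.
apply/allpairsP; exists (a, b); split=> //=.
  by have [_] := IH (size a) a ltac:(lia); apply.
by rewrite -e addKn; have [_] := IH (size b) b ltac:(lia); apply.
Qed.

Lemma uniq_nc_labels n : uniq (nc_labels n).
Proof.
have [N] := ubnP n; elim: N n => // N IH [|n] hn //.
rewrite nc_labelsS; apply: allpairs_uniq_dep => [|j|]; first exact: iota_uniq.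
  rewrite mem_iota => hj; apply: allpairs_uniq; rewrite ?IH //; try lia.
  move=> [t g] [t' g'] _ _ /= e; have es := glue_size_inj e.
  move/eqP: e; rewrite /glue_labels eqseq_cat ?size_rcons ?es // eqseq_rcons eqxx andbT.
  by case/andP => /eqP -> /eqP /inj_map -> // x y /addnI.
have key j s : existT (fun=> seq nat) j s \in
    [seq @Tagged nat j (fun=> seq nat) s | j <- iota 0 n.+1,
       s <- [seq glue_labels t g | t <- nc_labels j, g <- nc_labels (n - j)]] ->
    exists t g, size t = j /\ s = glue_labels t g.
  case/allpairsPdep=> k [u [hk hu e]].
  have ej : j = k := congr1 (fun p => tag p) e.
  have es : s = u := congr1 (fun p : {_ : nat & seq nat} => projT2 p) e.
  rewrite -ej -es in hu; case/allpairsP: hu => [[t g] /= [ht hg ->]].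
  by exists t, g; split=> //; have [h _] := mem_nc_labels j t; case: (h ht).
move=> [j s] [j' s'] /= /key[t [g [<- et]]] /key[t' [g' [<- et']]] e; subst s s'.
by rewrite e (glue_size_inj e).
Qed.

(** Labelling by first positions is a bijection of [NC n] onto the enumerated labellings. *)
Lemma sum_NC_labels (V : nmodType) n (G : seq nat -> V) :
  (\sum_(P in NC n) G (first_labels (block_labels P)) = \sum_(t <- nc_labels n) G t)%R.
Proof.
rewrite -big_enum /= -(big_map (fun P => first_labels (block_labels P)) xpredT G).
apply: perm_big; apply: uniq_perm; last 1 first.
- move=> t; apply/mapP/idP => [[P hP ->]|].
    have [_ h] := mem_nc_labels n (first_labels (block_labels P)).
    apply: h; rewrite size_first_labels size_block_labels; split=> //.
    by apply: NC_first_labels; rewrite mem_enum in hP.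
  have [h _] := mem_nc_labels n t; move=> /h[st ct].
  have [P hP et] := nc_labelling_NC st ct.
  by exists P; rewrite ?mem_enum.
- rewrite map_inj_in_uniq ?enum_uniq // => P Q; rewrite !mem_enum.
  exact: first_labels_inj.
- exact: uniq_nc_labels.
Qed.

Lemma sum_nc_labelsS (V : nmodType) n (G : seq nat -> V) :
  (\sum_(t <- nc_labels n.+1) G t =
   \sum_(j < n.+1) \sum_(t <- nc_labels j) \sum_(g <- nc_labels (n - j))
     G (glue_labels t g))%R.
Proof.
rewrite nc_labelsS big_allpairs_dep -[iota 0 _]/(index_iota 0 n.+1) big_mkord.
by apply: eq_bigr => j _; rewrite big_allpairs_dep.
Qed.

Local Open Scope ring_scope.

(** * The recursion for moments *)

Section MomentRecursion.
Context {K : pzRingType} {B M : algType K}.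
Variables (inc : {lrmorphism B -> M}) (E : {linear M -> B}) (kappa : seq M -> B).
Hypotheses (hE : cond_exp inc E) (hk : is_cumulants inc E kappa).
Implicit Types (u acc : seq M) (g x : M).

Let lin : multilinear kappa. Proof. by case: hk. Qed.
Let bal : balanced inc kappa. Proof. by case: hk. Qed.

Lemma expectation_labels u : (0 < size u)%N ->
  E (\prod_(x <- u) x) = \sum_(t <- nc_labels (size u)) bracket inc kappa t u.
Proof.
case: hk => _ _; case: u => // x u; set m := x :: u => mom _.
have := mom (size u) (fun i => nth 0 m i).
have -> : \prod_(i < (size u).+1) nth 0 m i = \prod_(x <- m) x.
  by rewrite [RHS](big_nth 0) big_mkord.
move=> ->; rewrite -sum_NC_labels; apply: eq_bigr => P _.
rewrite /cumulant_part -/(block_labels P).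
have -> : [seq nth 0 m (val i) | i <- enum 'I_(size u).+1] = m.
  by rewrite (map_comp (nth 0 m) val) val_enum_ord -/(mkseq _ _) mkseq_nth.
rewrite /first_labels [RHS]bracket_map_in //; apply: (@index_inj _ set0).
Qed.

(* The sum over the partitions for which all the positions of [acc] are in the
   block of the first position. *)
Definition block_sum u acc :=
  \sum_(t <- nc_labels (size u)) bracket inc kappa (t ++ nseq (size acc) 0%N) (u ++ acc).

Lemma block_sum_nil acc : block_sum [::] acc = kappa acc.
Proof. by rewrite /block_sum big_seq1 bracket_const ?constant_nseq. Qed.

(** Sort the partitions by the last position [j] of [u] in the block of the first letter. The rest
    of [u] is a gap, which [bracket_interval] brackets separately; by additivity its partitions sum
    up to an expectation, and an empty gap contributes [E 1 = 1]. *)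
Lemma block_sumE u acc : (0 < size u)%N ->
  block_sum u acc = \sum_(j < size u)
    block_sum (take j u) (nth 0 u j * inc (E (\prod_(x <- drop j.+1 u) x)) :: acc).
Proof.
case: hE => E1 _; rewrite /block_sum; case eu: (size u) => [//|n] _.
rewrite sum_nc_labelsS; apply: eq_bigr => j _.
have jn : (j < size u)%N by rewrite eu.
have stj : size (take j u) = j by rewrite size_takel // ltnW.
rewrite stj; apply: eq_big_seq => t ht.
have [st ct] : size t = j /\ nc_labelling t by have [h _] := mem_nc_labels j t; apply: h.
have eqv : u = take j u ++ nth 0 u j :: drop j.+1 u.
  by rewrite -drop_nth // cat_take_drop.
have sv : size (drop j.+1 u) = (n - j)%N by rewrite size_drop eu.
set v := drop j.+1 u in eqv sv *; set x := nth 0 u j in eqv *.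
have et : t ++ nseq (size acc).+1 0%N = rcons t 0%N ++ nseq (size acc) 0%N by rewrite cat_rcons.
rewrite /= et.
case: (posnP (n - j)) => [z|pos].
  rewrite z in sv *; rewrite big_seq1 /glue_labels /= cats0 {1}eqv.
  by rewrite (size0nil sv) big_nil E1 rmorph1 mulr1 -catA.
have [a [la ea]] : exists a, last 0%N a = 0%N /\ rcons t 0%N = 0%N :: a.
  case: t ct {ht st et} => [|y t] ct; first by exists [::].
  by have /= -> := nc_labelling_head ct; exists (rcons t 0%N); rewrite last_rcons.
have sa : size a = j by have := congr1 size ea; rewrite size_rcons st => -[->].
transitivity (\sum_(g <- nc_labels (n - j))
  bracket inc kappa ((0%N :: a) ++ nseq (size acc) 0%N) (take j u ++ x * inc (bracket inc kappa g v) :: acc)).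
  apply: eq_big_seq => g hg.
  have [sg cg] : size g = (n - j)%N /\ nc_labelling g by have [h _] := mem_nc_labels (n - j) g; apply: h.
  rewrite /glue_labels ea -catA {1}eqv -catA cat_cons.
  rewrite bracket_interval ?size_map ?sg ?stj ?sa //.
    by rewrite bracket_map_in // => y z _ _ /addnI.
  move=> l /mapP[y _ ->]; rewrite -ea mem_rcons inE addSn /=.
  apply/negP => /(nthP 0%N)[i ilt ei]; have [h _ _] := ct i ilt.
  move: h; rewrite ei ltnNge => /negP; apply; exact: leq_trans (ltnW ilt) (leq_addr _ _).
rewrite -bracket_sum //; last by rewrite size_cat size_nseq /= sa stj.
rewrite -mulr_sumr -rmorph_sum -sv -expectation_labels ?sv //.
by rewrite ea.
Qed.

(* Scanning the word from the right: [acc] contains the arguments of the block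
   of the first letter found so far, and [g] is the product of the letters
   between the position reached and the next element of the block. *)
Definition letter_op m (Phi : M -> seq M -> B) g acc :=
  Phi (m * g) acc + Phi 1 (m * inc (E g) :: acc).

Definition scalar_op b (Phi : M -> seq M -> B) g acc := Phi (inc b * g) acc.

Definition item_op (y : M + B) :=
  match y with inl m => letter_op m | inr b => scalar_op b end.

Definition item_val (y : M + B) : M := match y with inl m => m | inr b => inc b end.

(** The operator of the last letter is outermost, so evaluating the scan at a gap and a block reads
    the word from its right end. *)
Definition scan (w : seq (M + B)) Phi := foldl (fun Phi y => item_op y Phi) Phi w.

Definition scan_start m (kp : seq M -> B) g acc := kp (m * inc (E g) :: acc).

Lemma item_op_ext y (Phi Phi' : M -> seq M -> B) : Phi =2 Phi' -> item_op y Phi =2 item_op y Phi'.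
Proof. by move=> e g acc; case: y => z /=; rewrite /letter_op /scalar_op !e. Qed.

Lemma scan_ext w Phi Phi' : Phi =2 Phi' -> scan w Phi =2 scan w Phi'.
Proof. by elim: w Phi Phi' => //= y w IH Phi Phi' e; apply: IH; apply: item_op_ext. Qed.

Lemma scan_cat w w' Phi : scan (w ++ w') Phi = scan w' (scan w Phi).
Proof. exact: foldl_cat. Qed.

Lemma scan_rcons w y Phi : scan (rcons w y) Phi = item_op y (scan w Phi).
Proof. by rewrite -cats1 scan_cat. Qed.

Lemma scan_sub w Phi Phi' g acc :
  scan w (fun g acc => Phi g acc - Phi' g acc) g acc = scan w Phi g acc - scan w Phi' g acc.
Proof.
elim/last_ind: w g acc => [|w y IH] g acc //; rewrite !scan_rcons.
by case: y => z /=; rewrite /letter_op /scalar_op !IH // opprD addrACA.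
Qed.

(** Here [j] is the last letter put into the block during the scan; the letters behind it, together
    with the open gap [g], form the gap that it closes. *)
Lemma scan_letters m u g acc :
  scan (map inl u) (scan_start m kappa) g acc =
  \sum_(j < (size u).+1) block_sum (take j (m :: u))
     (nth 0 (m :: u) j * inc (E ((\prod_(x <- drop j.+1 (m :: u)) x) * g)) :: acc).
Proof.
elim/last_ind: u g acc => [|u x IH] g acc.
  by rewrite big_ord1 /= block_sum_nil big_nil mul1r.
rewrite map_rcons scan_rcons /= /letter_op !IH size_rcons [in RHS]big_ord_recr /=.
congr (_ + _).
  apply: eq_bigr => j _; have jn : (j < size (m :: u))%N := ltn_ord j.
  rewrite -rcons_cons nth_rcons jn drop_rcons // -!cats1 takel_cat; last exact: ltnW.
  by rewrite big_cat big_seq1 /= mulrA.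
rewrite nth_rcons ltnn eqxx -cats1 take_size_cat // drop_oversize ?size_cat ?addn1 //.
rewrite big_nil mul1r block_sumE //; apply: eq_bigr => j _.
by rewrite mulr1.
Qed.

(** Left [B]-linearity of [E] allows a coefficient to be merged into the letter before it, which
    reduces scans to words of letters only. *)
Fixpoint absorb m (w : seq (M + B)) : seq M :=
  match w with
  | [::] => [:: m]
  | inl m' :: w' => m :: absorb m' w'
  | inr b :: w' => absorb (m * inc b) w'
  end.

Lemma expectation_mull b x : E (inc b * x) = b * E x.
Proof. by case: hE => _ h; rewrite -[_ * x]mulr1 -(rmorph1 inc) h mulr1. Qed.

Lemma expectation_mulr b x : E (x * inc b) = E x * b.
Proof. by case: hE => _ h; rewrite -[x]mul1r -(rmorph1 inc) h mul1r rmorph1 mul1r. Qed.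

Lemma scan_absorb w m Phi : scan w (letter_op m Phi) =2 scan (map inl (absorb m w)) Phi.
Proof.
elim: w m Phi => [|[x|b] w IH] m Phi // g acc; first exact: IH.
rewrite /= -IH; apply: scan_ext => g' acc'; rewrite /scalar_op /letter_op.
by rewrite expectation_mull rmorphM !mulrA.
Qed.

Lemma prod_absorb w m : \prod_(x <- absorb m w) x = m * \prod_(y <- w) item_val y.
Proof.
elim: w m => [|[x|b] w IH] m /=; first by rewrite big_seq1 big_nil mulr1.
  by rewrite big_cons IH big_cons.
by rewrite IH big_cons mulrA.
Qed.

(** After absorption, [scan_letters] with gap 1 and empty block is the expansion [block_sumE], and
    [block_sum] with nothing collected runs over all non-crossing partitions. *)
Lemma expectation_scan m w :
  E (m * \prod_(y <- w) item_val y) = scan w (scan_start m kappa) 1 [::].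
Proof.
have [m' [u [<- ->]]] : exists m' u,
    m' * \prod_(x <- u) x = m * \prod_(y <- w) item_val y /\
    scan w (scan_start m kappa) 1 [::] = scan (map inl u) (scan_start m' kappa) 1 [::].
  elim: w m => [|[x|b] w IH] m; first by exists m, [::]; rewrite !big_nil.
    by exists m, (absorb x w); rewrite prod_absorb big_cons /= scan_absorb.
  have [m' [u [e1 e2]]] := IH (m * inc b); exists m', u.
  rewrite e1 -e2 big_cons mulrA; split=> //.
  change (scan w (scalar_op b (scan_start m kappa)) 1 [::] = scan w (scan_start (m * inc b) kappa) 1 [::]).
  apply: scan_ext => g acc.
  by rewrite /scalar_op /scan_start expectation_mull rmorphM mulrA.
rewrite scan_letters.
transitivity (block_sum (m' :: u) [::]).
  have -> : m' * \prod_(x <- u) x = \prod_(x <- m' :: u) x by rewrite big_cons.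
  rewrite expectation_labels //.
  by apply: eq_bigr => t _; rewrite !cats0.
by rewrite block_sumE //; apply: eq_bigr => j _; rewrite mulr1.
Qed.
End MomentRecursion.

(** * Words in X and D *)

Section Words.
Context {K : pzRingType} {D B M : algType K}.
Variables (incDB : {lrmorphism D -> B}) (incBM : {lrmorphism B -> M}).
Variables (E : {linear M -> B}) (n : nat) (X : 'I_n -> M).
Hypothesis (hE : cond_exp incBM E).
Implicit Types (Phi : M -> seq M -> B) (g : M) (acc : seq M).

Local Notation word := (seq ('I_n + D)).
Implicit Types (w : word) (l : seq (B * word)).

Definition word_item (y : 'I_n + D) : M + B :=
  match y with inl i => inl (X i) | inr d => inr (incDB d) end.

Definition word_val w : M := \prod_(y <- w) item_val incBM (word_item y).

Definition word_deg w := count (fun y => if y is inl _ then true else false) w.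

Definition word_scan w Phi := scan incBM E (map word_item w) Phi.

(** The operator of the factor [w - E(w)]: the word may be used letter by letter, whereas its
    expectation only enters the open gap as a coefficient. *)
Definition centered_op w Phi g acc :=
  word_scan w Phi g acc - Phi (incBM (E (word_val w)) * g) acc.

(* The formal counterpart of the multiplication by [centered_val l] below. *)
Definition centered_scan l Phi :=
  foldl (fun Phi p => centered_op p.2 (scalar_op incBM p.1 Phi)) Phi l.

Definition centered_val l : M :=
  \prod_(p <- l) (incBM p.1 * (word_val p.2 - incBM (E (word_val p.2)))).

Definition centered_deg l := sumn (map (fun p => word_deg p.2) l).

Lemma word_val_nil : word_val [::] = 1. Proof. exact: big_nil. Qed.

Lemma word_val_letter i : word_val [:: inl i] = X i. Proof. exact: big_seq1. Qed.

Lemma word_val_cons y w : word_val (y :: w) = item_val incBM (word_item y) * word_val w.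
Proof. exact: big_cons. Qed.

Lemma word_val_cat w w' : word_val (w ++ w') = word_val w * word_val w'.
Proof. exact: big_cat. Qed.

Lemma word_val_rcons w y : word_val (rcons w y) = word_val w * item_val incBM (word_item y).
Proof. by rewrite -cats1 word_val_cat /word_val big_seq1. Qed.

Lemma centered_val_nil : centered_val [::] = 1. Proof. exact: big_nil. Qed.

Lemma centered_val_cons p l : centered_val (p :: l) =
  incBM p.1 * (word_val p.2 - incBM (E (word_val p.2))) * centered_val l.
Proof. exact: big_cons. Qed.

Lemma centered_val_rcons l p : centered_val (rcons l p) =
  centered_val l * (incBM p.1 * (word_val p.2 - incBM (E (word_val p.2)))).
Proof. by rewrite -cats1 /centered_val big_cat big_seq1. Qed.

Lemma word_deg_cat w w' : word_deg (w ++ w') = (word_deg w + word_deg w')%N.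
Proof. exact: count_cat. Qed.

Lemma word_deg_rcons w y : word_deg (rcons w y) = (word_deg w + word_deg [:: y])%N.
Proof. by rewrite -cats1 word_deg_cat. Qed.

Lemma centered_deg_cat l l' : centered_deg (l ++ l') = (centered_deg l + centered_deg l')%N.
Proof. by rewrite /centered_deg map_cat sumn_cat. Qed.

Lemma centered_deg_rcons l p : centered_deg (rcons l p) = (centered_deg l + word_deg p.2)%N.
Proof. by rewrite -cats1 centered_deg_cat /centered_deg /= addn0. Qed.

Lemma word_scan_rcons w y Phi :
  word_scan (rcons w y) Phi = item_op incBM E (word_item y) (word_scan w Phi).
Proof. by rewrite /word_scan map_rcons scan_rcons. Qed.

Lemma word_scan_ext w Phi Phi' : Phi =2 Phi' -> word_scan w Phi =2 word_scan w Phi'.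
Proof. exact: scan_ext. Qed.

Lemma centered_scan_rcons l p Phi : centered_scan (rcons l p) Phi =
  centered_op p.2 (scalar_op incBM p.1 (centered_scan l Phi)).
Proof. by rewrite /centered_scan foldl_rcons. Qed.

Lemma centered_op_ext w Phi Phi' : Phi =2 Phi' -> centered_op w Phi =2 centered_op w Phi'.
Proof. by move=> e g acc; rewrite /centered_op e (word_scan_ext _ e). Qed.

Lemma centered_scan_ext l Phi Phi' : Phi =2 Phi' -> centered_scan l Phi =2 centered_scan l Phi'.
Proof.
move=> e; elim/last_ind: l => [//|l p IH] g acc; rewrite !centered_scan_rcons.
by apply: centered_op_ext => g' acc'; apply: IH.
Qed.

Lemma centered_scan_sub l Phi Phi' g acc :
  centered_scan l (fun g acc => Phi g acc - Phi' g acc) g acc =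
  centered_scan l Phi g acc - centered_scan l Phi' g acc.
Proof.
elim/last_ind: l g acc => [//|l p IH] g acc; rewrite !centered_scan_rcons.
rewrite (@centered_op_ext _ _ (fun g acc =>
  scalar_op incBM p.1 (centered_scan l Phi) g acc -
  scalar_op incBM p.1 (centered_scan l Phi') g acc)); last by move=> g' acc'; apply: IH.
by rewrite /centered_op /word_scan scan_sub {2}/scalar_op opprD addrACA -opprD.
Qed.

Section Expectation.
Variable kappa : seq M -> B.
Hypothesis hk : is_cumulants incBM E kappa.

Lemma expectation_centered m w l :
  E (m * word_val w * centered_val l) =
  centered_scan l (word_scan w (scan_start incBM E m kappa)) 1 [::].
Proof.
(* Coefficients in [B] are allowed in [p], because the induction moves both terms of the first
   centred factor into it, and [E(w)] need not lie in [D]. *)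
suff h (p : seq (M + B)) : E (m * (\prod_(y <- p) item_val incBM y) * centered_val l) =
    centered_scan l (scan incBM E p (scan_start incBM E m kappa)) 1 [::].
  by rewrite -h big_map.
elim: l p => [|[b v] l IH] p.
  by rewrite centered_val_nil mulr1 (expectation_scan hE hk).
rewrite centered_val_cons /=.
pose p1 := p ++ inr b :: map word_item v.
pose p2 := p ++ [:: inr b; inr (E (word_val v))].
transitivity (centered_scan l (fun g acc =>
    scan incBM E p1 (scan_start incBM E m kappa) g acc -
    scan incBM E p2 (scan_start incBM E m kappa) g acc) 1 [::]).
  rewrite centered_scan_sub -!IH -linearB /= !big_cat !big_cons big_map big_nil /=.
  by rewrite mulr1 -/(word_val v) -mulrBl -!mulrBr !mulrA.
apply: centered_scan_ext => g acc.
by rewrite /centered_op /p1 /p2 !scan_cat.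
Qed.
End Expectation.

Definition scan_multilinear Phi :=
  (forall a x y acc, Phi (a *: x + y) acc = a *: Phi x acc + Phi y acc) /\
  (forall g, multilinear (Phi g)).

Lemma scan_start_multilinear kp m : multilinear kp ->
  scan_multilinear (scan_start incBM E m kp).
Proof.
move=> h; split=> [a x y acc|g u v a x y]; rewrite /scan_start; last exact: (h (_ :: u)).
by rewrite !linearP /= mulrDr -scalerAr; apply: (h [::]).
Qed.

Lemma item_op_multilinear y Phi : scan_multilinear Phi ->
  scan_multilinear (item_op incBM E y Phi).
Proof.
case=> h1 h2; case: y => [m|b] /=; split=> [a x z acc|g u v a x z] /=;
    rewrite /letter_op /scalar_op ?h2 //.
- rewrite !linearP /= !mulrDr -!scalerAr h1 (h2 _ [::]) /=.
  by rewrite scalerDr addrACA.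
- by rewrite (h2 _ (_ :: u)) /= scalerDr addrACA.
- by rewrite mulrDr -scalerAr h1.
Qed.

Lemma word_scan_multilinear w Phi : scan_multilinear Phi -> scan_multilinear (word_scan w Phi).
Proof.
move=> h; elim/last_ind: w => [//|w y IH]; rewrite word_scan_rcons.
exact: item_op_multilinear.
Qed.

Lemma centered_scan_multilinear l Phi : scan_multilinear Phi ->
  scan_multilinear (centered_scan l Phi).
Proof.
move=> h; elim/last_ind: l => [//|l [b w] IH]; rewrite centered_scan_rcons /=.
have hs : scan_multilinear (scalar_op incBM b (centered_scan l Phi)).
  exact: (item_op_multilinear (inr b)).
have hw := word_scan_multilinear w hs.
case: hw hs => w1 w2 [s1 s2]; split=> [a x y acc|g u v a x y]; rewrite /centered_op.
  by rewrite w1 mulrDr -scalerAr s1 scalerBr opprD addrACA.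
by rewrite w2 s2 scalerBr opprD addrACA.
Qed.

Lemma scan_multilinearB Phi x y acc : scan_multilinear Phi ->
  Phi x acc - Phi y acc = Phi (x - y) acc.
Proof. by case=> h _; rewrite addrC -scaleN1r -h scaleN1r addrC. Qed.

Section Dead.
(* Intended for the lists of arguments on which the cumulants vanish, whichever
   arguments are added in front. *)
Variable dead : seq M -> Prop.
Hypothesis dead_cons : forall i b acc, dead acc -> dead (X i * incBM b :: acc).

Definition respects_dead Phi := forall g acc, dead acc -> Phi g acc = 0.

Lemma word_scan_dead w Phi : respects_dead Phi -> respects_dead (word_scan w Phi).
Proof.
move=> h; elim/last_ind: w => [//|w y IH] g acc da; rewrite word_scan_rcons.
case: y => [i|d] /=; rewrite /letter_op /scalar_op !IH ?addr0 //.
exact: dead_cons.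
Qed.

Lemma centered_scan_dead l Phi : respects_dead Phi -> respects_dead (centered_scan l Phi).
Proof.
move=> h; elim/last_ind: l => [//|l [b w] IH] g acc da; rewrite centered_scan_rcons.
rewrite /centered_op word_scan_dead // /scalar_op ?IH ?subr0 // => g' acc' da'.
exact: IH.
Qed.

(** If every letter that could enter the block next produces a dead list, only the branch in which
    the whole word joins the gap survives. *)
Lemma word_scan_skip w Phi g acc : respects_dead Phi ->
  (forall w' i w'', w = w' ++ inl i :: w'' ->
     dead (X i * incBM (E (word_val w'' * g)) :: acc)) ->
  word_scan w Phi g acc = Phi (word_val w * g) acc.
Proof.
move=> rP; elim/last_ind: w g => [|w y IH] g hd; first by rewrite word_val_nil mul1r.
rewrite word_scan_rcons word_val_rcons.
have {}IH : word_scan w Phi (item_val incBM (word_item y) * g) acc =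
    Phi (word_val w * item_val incBM (word_item y) * g) acc.
  rewrite IH ?mulrA // => w' i w'' e; rewrite mulrA -word_val_rcons.
  by apply: (hd w'); rewrite e rcons_cat.
case: y hd IH => [i|d] hd IH //=; rewrite /letter_op IH word_scan_dead ?addr0 //.
have := hd w i [::]; rewrite word_val_nil mul1r; apply.
by rewrite cats1.
Qed.

Lemma centered_scan_skip l Phi g acc : respects_dead Phi -> scan_multilinear Phi ->
  (forall l1 b w' i w'' l2, l = l1 ++ (b, w' ++ inl i :: w'') :: l2 ->
     dead (X i * incBM (E (word_val w'' * (centered_val l2 * g))) :: acc)) ->
  centered_scan l Phi g acc = Phi (centered_val l * g) acc.
Proof.
move=> rP mP; elim/last_ind: l g => [|l [b w] IH] g hd; first by rewrite centered_val_nil mul1r.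
rewrite centered_scan_rcons centered_val_rcons /= -mulrA -IH; last first.
  move=> l1 b' w' i w'' l2 e; rewrite [centered_val _ * _]mulrA -(centered_val_rcons _ (b, w)).
  by apply: (hd l1 b' w'); rewrite e rcons_cat.
rewrite /centered_op word_scan_skip.
- rewrite /scalar_op scan_multilinearB; last exact: centered_scan_multilinear.
  by rewrite -mulrBr -mulrBl mulrA.
- by move=> g' acc'; apply: centered_scan_dead.
move=> w' i w'' e; have := hd l b w' i w'' [::].
by rewrite e cats1 centered_val_nil mul1r; apply.
Qed.
End Dead.
End Words.

(** * Vanishing of scans of centred products *)

Section Vanishing.
Context {K : pzRingType} {D B M : algType K}.
Variables (incDB : {lrmorphism D -> B}) (incBM : {lrmorphism B -> M}).
Variables (E : {linear M -> B}) (F : {linear B -> D}) (n : nat) (X : 'I_n -> M).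
Hypotheses (hE : cond_exp incBM E) (hF : cond_exp incDB F).
Local Notation word := (seq ('I_n + D)).
Implicit Types (Phi : M -> seq M -> B) (g : M) (acc v : seq M) (w : word)
  (l : seq (B * word)).

Local Notation val := (word_val incDB incBM X).
Local Notation cval := (centered_val incDB incBM E X).
Local Notation deg := (@word_deg _ D n).
Local Notation cdeg := (@centered_deg _ D B n).
Local Notation wscan := (word_scan incDB incBM E X).
Local Notation cscan := (centered_scan incDB incBM E X).
Local Notation start := (scan_start incBM E).

Definition X_args v := forall x, x \in v -> exists i b, x = X i * incBM b.

Definition F_centered l := forall p, p \in l -> F p.1 = 0.

Lemma X_args_cons i b v : X_args v -> X_args (X i * incBM b :: v).
Proof. by move=> h x; rewrite inE => /orP[/eqP->|/h//]; exists i, b. Qed.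

Lemma F_centered_rcons l p : F_centered (rcons l p) <-> F_centered l /\ F p.1 = 0.
Proof.
split=> [h|[h hp] q].
  by split=> [q ql|]; apply: h; rewrite mem_rcons inE ?ql ?eqxx ?orbT.
by rewrite mem_rcons inE => /orP[/eqP->|/h].
Qed.

Lemma F_centered_cat l l' : F_centered (l ++ l') <-> F_centered l /\ F_centered l'.
Proof.
split=> [h|[h h'] p].
  by split=> p hp; apply: h; rewrite mem_cat hp ?orbT.
by rewrite mem_cat => /orP[/h|/h'].
Qed.

Lemma F_mull d b : F (incDB d * b) = d * F b.
Proof. exact: expectation_mull. Qed.

Lemma F_mulr d b : F (b * incDB d) = F b * d.
Proof. exact: expectation_mulr. Qed.

Section WordScan.
Variables (Phi : M -> seq M -> B) (k : nat).
Hypothesis hPhi : forall w acc, (deg w <= k)%N -> X_args acc -> acc != [::] ->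
  Phi (val w) acc = 0.

(** Each letter either lengthens the gap, which remains a word, or closes it and starts again from
    the empty word with a longer block; the hypothesis on [Phi] covers every outcome. *)
Lemma word_scan_acc w w' acc : (deg w + deg w' <= k)%N -> X_args acc -> acc != [::] ->
  wscan w Phi (val w') acc = 0.
Proof.
elim/last_ind: w w' acc => [|w y IH] w' acc; first exact: hPhi.
rewrite word_scan_rcons word_deg_rcons => hd ha hn.
case: y hd => [i|d] /= hd; rewrite /letter_op /scalar_op.
  have -> : X i * val w' = val (inl i :: w') by rewrite word_val_cons.
  rewrite IH ?addr0 ?add0r //; last by rewrite /= in hd *; lia.
  rewrite -(word_val_nil incDB incBM X) IH //; first by rewrite /= in hd *; lia.
  exact: X_args_cons.
have -> : incBM (incDB d) * val w' = val (inr d :: w') by rewrite word_val_cons.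
by rewrite IH //; rewrite /= in hd *; lia.
Qed.

(** Once a letter is put into the block, [word_scan_acc] applies; only the branch that takes none
    remains. *)
Lemma word_scan_nil w w' : (deg w + deg w' <= k)%N ->
  wscan w Phi (val w') [::] = Phi (val w * val w') [::].
Proof.
elim/last_ind: w w' => [|w y IH] w'; first by rewrite word_val_nil mul1r.
rewrite word_scan_rcons word_deg_rcons word_val_rcons => hd.
rewrite -mulrA -word_val_cons; case: y hd => [i|d] /= hd; rewrite /letter_op /scalar_op.
  have -> : X i * val w' = val (inl i :: w') by rewrite word_val_cons.
  rewrite IH; last by rewrite /= in hd *; lia.
  rewrite -(word_val_nil incDB incBM X) word_scan_acc ?addr0 //.
    by rewrite /= in hd *; lia.
  exact: X_args_cons.
have -> : incBM (incDB d) * val w' = val (inr d :: w') by rewrite word_val_cons.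
by rewrite IH //; rewrite /= in hd *; lia.
Qed.
End WordScan.

Hypothesis valD : forall w, E (val w) = incDB (F (E (val w))).

Variable N : nat.
Hypothesis vanishN : forall w l, F_centered l -> l != [::] ->
  (deg w + cdeg l < N)%N -> E (val w * cval l) = 0.

(** By vanishing, the final [w'] may be replaced by [E(w')], which is in [D] and comes out of [F].
    What remains vanishes again, or for empty [l] is [F(E(w) b)] with [E(w)] in [D]. *)
Lemma F_expectation_centered w l b w' : F_centered l -> F b = 0 ->
  (deg w + cdeg l + deg w' < N)%N ->
  F (E (val w * (cval l * (incBM b * val w')))) = 0.
Proof.
move=> hl hb hd.
have hl' : F_centered (rcons l (b, w')) by apply/F_centered_rcons.
have hz : E (val w * cval (rcons l (b, w'))) = 0.
  by apply: vanishN => //; [case: (l) | rewrite centered_deg_rcons /=; lia].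
rewrite centered_val_rcons /= mulrBr 2!mulrBr linearB /= in hz.
move/eqP: hz; rewrite subr_eq0 => /eqP ->.
rewrite !mulrA !(expectation_mulr hE) valD F_mulr.
have [->|ln] := eqVneq l [::].
  by rewrite centered_val_nil mulr1 valD F_mull hb mulr0 mul0r.
rewrite vanishN ?mul0r ?linear0 ?mul0r //; lia.
Qed.

Variable kp : seq M -> B.
Hypothesis kp_lin : multilinear kp.
Hypothesis kp_kill : forall v i b acc, X_args v -> X_args acc -> acc != [::] ->
  F b = 0 -> kp (v ++ X i * incBM b :: acc) = 0.

(** The degree bound does not count the first letter: gaps never contain it, so vanishing below [N]
    suffices. The functional [kp] is general so that truncated cumulants are covered as well. *)
Lemma centered_scan_vanish i w l : F_centered l -> l != [::] ->
  (deg w + cdeg l < N)%N -> cscan l (wscan w (start (X i) kp)) 1 [::] = 0.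
Proof.
move=> hl ln hd.
pose dead acc := forall v, X_args v -> kp (v ++ acc) = 0.
have dead_cons j b acc : dead acc -> dead (X j * incBM b :: acc).
  move=> h v hv; rewrite -cat_rcons; apply: h => x.
  by rewrite mem_rcons inE => /orP[/eqP->|/hv//]; exists j, b.
have dead0 j acc : dead (X j * incBM 0 :: acc).
  by move=> v _; rewrite rmorph0 mulr0 kappa_lin0.
(* For empty [acc] the coefficient [b] would be outermost and an F-centred value would not be
   enough; then it has to be 0. *)
have deadF j b acc : F b = 0 -> X_args acc -> acc != [::] -> dead (X j * incBM b :: acc).
  by move=> hb ha an v hv; apply: kp_kill.
have r0 : respects_dead dead (start (X i) kp).
  move=> g acc da; rewrite /scan_start -cat1s da // => x.
  by rewrite inE => /eqP ->; exists i, (E g).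
have rw : respects_dead dead (wscan w (start (X i) kp)) by apply: word_scan_dead.
have mw : scan_multilinear (wscan w (start (X i) kp)).
  by apply: word_scan_multilinear; apply: scan_start_multilinear.
move: (hl) (hd); case/lastP: l hl ln hd => [//|l [b v]] hl' _ hd'.
move=> /F_centered_rcons[hl /= hb]; rewrite centered_deg_rcons /= => hd {hl' hd'}.
have hl2 l1 b' w1 l2 : l = l1 ++ (b', w1) :: l2 ->
    F_centered l2 /\ (word_deg w1 + cdeg l2 <= cdeg l)%N.
  move=> e; move: hl; rewrite e -cat_rcons => /F_centered_cat[_ ?]; split=> //.
  by rewrite centered_deg_cat centered_deg_rcons /=; lia.
have degE w1 (j : 'I_n) w2 : deg (w1 ++ inl j :: w2) = (deg w1 + (deg w2).+1)%N.
  by rewrite word_deg_cat.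
pose Theta := scalar_op incBM b (cscan l (wscan w (start (X i) kp))).
(* If the block already has a letter behind [b], its next letter to the left closes a gap over [b]
   with F-centred expectation and is dead. Even the first letter [X i] does so. *)
have hTheta w' acc : (deg w' <= deg v)%N -> X_args acc -> acc != [::] ->
    Theta (val w') acc = 0.
  move=> hw' ha an; rewrite /Theta /scalar_op (centered_scan_skip dead_cons rw mw).
    rewrite (word_scan_skip dead_cons r0).
      apply: (kp_kill (v := [::])) => //.
      by rewrite F_expectation_centered //; lia.
    move=> w1 j w2 e; apply: deadF => //.
    by rewrite F_expectation_centered //; move: hd; rewrite e degE; lia.
  move=> l1 b' w1 j w2 l2 /hl2; rewrite degE => -[hc hdl].
  by apply: deadF => //; rewrite F_expectation_centered //; lia.
have mT : scan_multilinear Theta.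
  have h : scan_multilinear (cscan l (wscan w (start (X i) kp))).
    exact: centered_scan_multilinear.
  exact: item_op_multilinear (inr b) _ h.
(* So no letter of [v] enters the block, and the operator of the last centred factor puts [v - E(v)]
   into the gap. Every gap over this factor then has expectation 0, not only an F-centred one. *)
rewrite centered_scan_rcons /centered_op /= -/Theta.
rewrite -{1}(word_val_nil incDB incBM X) (word_scan_nil hTheta) ?addn0 //.
rewrite word_val_nil (scan_multilinearB _ _ _ mT) !mulr1 /Theta /scalar_op.
have vanish_rcons w' l' : F_centered l' -> (deg w' + cdeg l' + deg v < N)%N ->
    E (val w' * (cval l' * (incBM b * (val v - incBM (E (val v)))))) = 0.
  move=> hl' hd'; rewrite -(centered_val_rcons _ _ _ _ _ (b, v)) vanishN //.
  - by apply/F_centered_rcons.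
  - by case: (l').
  - by rewrite centered_deg_rcons /=; lia.
rewrite (centered_scan_skip dead_cons rw mw).
  rewrite (word_scan_skip dead_cons r0).
    by rewrite /scan_start vanish_rcons ?rmorph0 ?mulr0 ?(kappa_lin0 kp_lin [::]) //; lia.
  move=> w1 j w2 e; rewrite vanish_rcons //.
  by move: hd; rewrite e degE; lia.
move=> l1 b' w1 j w2 l2 /hl2; rewrite degE => -[hc hdl].
by rewrite vanish_rcons //; lia.
Qed.
End Vanishing.

Lemma cond_exp_comp (K : pzRingType) (D B M : algType K)
  (incDB : {lrmorphism D -> B}) (incBM : {lrmorphism B -> M})
  (E : {linear M -> B}) (F : {linear B -> D}) :
  cond_exp incBM E -> cond_exp incDB F -> cond_exp (incBM \o incDB) (F \o E).
Proof. by case=> E1 hE [F1 hF]; split=> [|b m b'] /=; rewrite ?E1 ?F1 // hE hF. Qed.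

(** * Words with expectation in D, and the vanishing of centred products *)

Section Restriction.
Context {K : pzRingType} {D B M : algType K}.
Variables (incDB : {lrmorphism D -> B}) (incBM : {lrmorphism B -> M}).
Variables (E : {linear M -> B}) (F : {linear B -> D}) (n : nat) (X : 'I_n -> M).
Hypotheses (hE : cond_exp incBM E) (hF : cond_exp incDB F).
Local Notation word := (seq ('I_n + D)).
Implicit Types (g : M) (acc v : seq M) (w : word) (l : seq (B * word)).

Local Notation val := (word_val incDB incBM X).
Local Notation cval := (centered_val incDB incBM E X).
Local Notation deg := (@word_deg _ D n).
Local Notation cdeg := (@centered_deg _ D B n).
Local Notation wscan := (word_scan incDB incBM E X).
Local Notation cscan := (centered_scan incDB incBM E X).
Local Notation start := (scan_start incBM E).
Local Notation incDM := (incBM \o incDB).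
Local Notation ED := (F \o E).

Lemma F_inc d : F (incDB d) = d.
Proof.
have [F1 _] := hF; have := expectation_mulr hF d 1.
by rewrite mul1r F1 mul1r.
Qed.

Definition XD_args v := forall x, x \in v -> exists i d, x = X i * incBM (incDB d).

Lemma XD_args_cons i d v : XD_args v -> XD_args (X i * incBM (incDB d) :: v).
Proof. by move=> h x; rewrite inE => /orP[/eqP->|/h//]; exists i, d. Qed.

Section Compare.
Variables (Phi : M -> seq M -> B) (Phi' : M -> seq M -> D) (k : nat).
Hypothesis valk : forall w, (deg w <= k)%N -> E (val w) = incDB (F (E (val w))).
Hypothesis hPhi : forall w acc, (deg w <= k)%N -> XD_args acc ->
  Phi (val w) acc = incDB (Phi' (val w) acc).

(** Every closed gap is a word, so its expectation is in [D] and the collected arguments keep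
    coefficients in [D]. On the right [D] is the base algebra, whence [idfun]. *)
Lemma word_scan_compare w w' acc : (deg w + deg w' <= k)%N -> XD_args acc ->
  wscan w Phi (val w') acc = incDB (word_scan idfun incDM ED X w Phi' (val w') acc).
Proof.
elim/last_ind: w w' acc => [|w y IH] w' acc; first exact: hPhi.
rewrite !word_scan_rcons word_deg_rcons => hd ha.
case: y hd => [i|d] /= hd; rewrite /letter_op /scalar_op.
  rewrite -(word_val_cons incDB incBM X (inl i)) rmorphD IH //=; last by rewrite /= in hd *; lia.
  congr (_ + _); rewrite -(word_val_nil incDB incBM X) IH //=.
  - by congr (incDB (_ _ (_ :: _))); rewrite {1}valk //; lia.
  - by rewrite /= in hd *; lia.
  - by rewrite valk; [apply: XD_args_cons | lia].
by rewrite -(word_val_cons incDB incBM X (inr d)) IH //; rewrite /= in hd *; lia.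
Qed.
End Compare.

Variable kappa : seq M -> B.
Hypothesis hk : is_cumulants incBM E kappa.

Lemma expectation_word i w : E (X i * val w) = wscan w (start (X i) kappa) 1 [::].
Proof.
have := expectation_centered incDB X hE hk (X i) w [::].
by rewrite centered_val_nil mulr1.
Qed.

Lemma expectation_val_scalar d w : E (val (inr d :: w)) = incDB d * E (val w).
Proof. by rewrite word_val_cons /= (expectation_mull hE). Qed.

Section Distribution.
Hypothesis kappaD : forall v, XD_args v -> v != [::] -> kappa v = incDB (F (kappa v)).

Lemma val_in_D w : E (val w) = incDB (F (E (val w))).
Proof.
have [N] := ubnP (deg w); elim: N w => // N IH; elim=> [|[i|d] w IHw] hd.
- by rewrite word_val_nil (proj1 hE) (proj1 hF) rmorph1.
- have hd' : (deg w < N)%N by [].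
  rewrite word_val_cons /= expectation_word -(word_val_nil incDB incBM X).
  (* Comparison with a [D]-valued functional exhibits the scan as an element of [D]; by [kappaD] the
     functional may be [F] of the start itself, since gaps have fewer letters. *)
  rewrite (word_scan_compare (Phi' := fun g acc => F (start (X i) kappa g acc)) (k := deg w)) //.
  + by rewrite F_inc.
  + by move=> w' hw'; apply: IH; lia.
  move=> w' acc hw' ha; apply: kappaD => //; rewrite IH; last by lia.
  exact: XD_args_cons.
  by rewrite addn0.
- by rewrite expectation_val_scalar IHw // (F_mull hF) F_inc rmorphM.
Qed.
End Distribution.

Section AllVanish.
Hypothesis valD : forall w, E (val w) = incDB (F (E (val w))).
Hypothesis kill : forall v i b acc, X_args incBM X v -> X_args incBM X acc -> acc != [::] ->
  F b = 0 -> kappa (v ++ X i * incBM b :: acc) = 0.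

(** The outer induction counts letters, the inner one all symbols: the inner one peels off leading
    coefficients, until a leading letter makes the scan available. *)
Lemma expectation_centered_vanish w l : F_centered F l -> l != [::] -> E (val w * cval l) = 0.
Proof.
have kappa_lin : multilinear kappa by case: hk.
have [N] := ubnP (deg w + cdeg l); elim: N w l => // N IHN w l.
have [s] := ubnP (size w + size l + sumn (map (fun p => size p.2) l)).
elim: s w l => // s IH [|[i|d] w] l hs hd hl ln.
(* Without a leading word, [b] comes out of [E]. Then [w] becomes the leading word and [E(w)] comes
   out as well; if nothing follows, the two terms cancel. *)
- case: l hl ln hs hd => [//|[b w] l] hl _ hs hd.
  rewrite word_val_nil mul1r centered_val_cons /= -mulrA (expectation_mull hE) mulrBl linearB /=.
  have hl' : F_centered F l by move=> p pl; apply: hl; rewrite inE pl orbT.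
  have [l0|ln] := eqVneq l [::].
    rewrite l0 centered_val_nil !mulr1 -[incBM _]mulr1 (expectation_mull hE).
    by rewrite (proj1 hE) mulr1 subrr mulr0.
  rewrite IH //; last first.
  + by rewrite /= in hs *; lia.
  rewrite (expectation_mull hE) -[cval l]mul1r -(word_val_nil incDB incBM X) IH //.
  + by rewrite mulr0 subr0 mulr0.
  + by rewrite /= in hs *; lia.
  + by move: hd; rewrite /centered_deg /=; lia.
- rewrite word_val_cons (expectation_centered incDB X hE hk).
  apply: (centered_scan_vanish hE hF valD (N := N)) => // w' l' hl' ln' hd'.
  exact: IHN.
- rewrite word_val_cons /= -mulrA (expectation_mull hE) IH ?mulr0 //.
Qed.
End AllVanish.
End Restriction.

From mathcomp Require Import classical_sets reals complex.

(** * Freeness *)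

Section Freeness.
Context {K : pzRingType} {D B M : algType K}.
Variables (incDB : {lrmorphism D -> B}) (incBM : {lrmorphism B -> M}).
Variables (E : {linear M -> B}) (F : {linear B -> D}) (n : nat) (X : 'I_n -> M).
Hypotheses (hE : cond_exp incBM E) (hF : cond_exp incDB F).
Local Notation word := (seq ('I_n + D)).
Implicit Types (g x y : M) (w : word) (l : seq (B * word)) (s : seq M).

Local Notation val := (word_val incDB incBM X).
Local Notation cval := (centered_val incDB incBM E X).
Local Notation ED := (F \o E).
Local Notation algX := (generated_alg (range (incBM \o incDB) `|` range X)%classic).

Fixpoint alternating (M1 M2 : set M) (c : bool) s : Prop :=
  if s is x :: s' then
    [/\ if c then M2 x else M1 x, ED x = 0 & alternating M1 M2 (~~ c) s']
  else True.

Lemma alternating_nth M1 M2 c s j : alternating M1 M2 c s -> (j < size s)%N ->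
  (if c (+) odd j then M2 else M1) (nth 0 s j) /\ ED (nth 0 s j) = 0.
Proof.
elim: s c j => // x s IH c [|j] /= [hx ex hs] hj; first by rewrite addbF; case: c hx {hs}.
by have := IH _ _ hs hj; rewrite addNb addbN.
Qed.

Lemma alternating_ord M1 M2 c k (a : 'I_k -> M) :
  (forall j : 'I_k, (if c (+) odd j then M2 else M1) (a j)) -> (forall j, ED (a j) = 0) ->
  exists s, [/\ alternating M1 M2 c s, size s = k & \prod_j a j = \prod_(x <- s) x].
Proof.
elim: k c a => [|k IH] c a ha ea; first by exists [::]; rewrite big_ord0 big_nil.
have [||s [hs ss es]] := IH (~~ c) (fun j => a (lift ord0 j)).
- by move=> j; have := ha (lift ord0 j); rewrite /= addNb addbN.
- by move=> j; apply: ea.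
exists (a ord0 :: s); rewrite big_ord_recl big_cons es /= ss; split=> //.
split=> //; last exact: ea.
by have := ha ord0; rewrite addbF; case: (c).
Qed.

Lemma free_amalgP (M1 M2 : set M) : free_amalg ED M1 M2 <->
  forall c s, s != [::] -> alternating M1 M2 c s -> ED (\prod_(x <- s) x) = 0.
Proof.
split=> [h c s sn hs|h k a c ha ea].
  case: s sn hs => // x s _; set s' := x :: s => hs.
  rewrite (big_nth 0) big_mkord; apply: (h (size s) _ c) => j.
    by have [] := alternating_nth hs (ltn_ord j).
  by have [] := alternating_nth hs (ltn_ord j).
have [s [hs ss ->]] := alternating_ord ha ea.
by apply: h hs; rewrite -size_eq0 ss.
Qed.

(** A description of the generated algebra by words, over which multilinear statements can be
    checked by induction. *)
Inductive word_span : M -> Prop :=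
| WordSpanVal w : word_span (val w)
| WordSpanLinear a x y : word_span x -> word_span y -> word_span (a *: x + y).

Lemma word_span_mul x y : word_span x -> word_span y -> word_span (x * y).
Proof.
move=> hx hy; elim: hx => [w|a x1 x2 _ h1 _ h2]; last first.
  by rewrite mulrDl -scalerAl; apply: WordSpanLinear.
elim: hy => [w'|a y1 y2 _ h1 _ h2]; first by rewrite -word_val_cat; apply: WordSpanVal.
by rewrite mulrDr -scalerAr; apply: WordSpanLinear.
Qed.

Lemma algX_word_span x : algX x -> word_span x.
Proof.
apply; split=> [|y]; last first.
  case=> [[d _ <-]|[i _ <-]].
    have -> : (incBM \o incDB) d = val [:: inr d] by rewrite /word_val big_seq1.
    exact: WordSpanVal.
  by rewrite -(word_val_letter incDB incBM X); apply: WordSpanVal.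
split=> [|a u v|u v].
- by apply/mem_set; rewrite -(word_val_nil incDB incBM X); apply: WordSpanVal.
- by move=> /set_mem hu /set_mem hv; apply/mem_set; apply: WordSpanLinear.
- by move=> /set_mem hu /set_mem hv; apply/mem_set; apply: word_span_mul.
Qed.

Lemma word_span_algX x : word_span x -> algX x.
Proof.
move=> hx A [[h1 hl hm] hG]; elim: hx => [w|a y z _ hy _ hz]; last first.
  by apply/set_mem; apply: hl; apply/mem_set.
elim: w => [|y w IH]; first by rewrite word_val_nil; apply/set_mem.
rewrite word_val_cons; apply/set_mem; apply: hm; apply/mem_set => //.
by apply: hG; case: y => [i|d]; [right; exists i | left; exists d].
Qed.

Section VanishToFree.
Hypothesis valD : forall w, E (val w) = incDB (F (E (val w))).
Hypothesis vanish : forall w l, F_centered F l -> l != [::] -> E (val w * cval l) = 0.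

Lemma word_span_in_D x : word_span x -> E x = incDB (F (E x)).
Proof. by elim=> // a y z _ hy _ hz; rewrite !linearP /= -hy -hz. Qed.

Implicit Types (r : seq (B * M)).

Definition pair_val r : M := \prod_(p <- r) (incBM p.1 * (p.2 - incBM (E p.2))).

Definition span_centered r := forall p, p \in r -> F p.1 = 0 /\ word_span p.2.

(** Factors with elements of the algebra are moved from [r] to [l] one by one, after reduction to a
    word by linearity of [x - E(x)]. *)
Lemma pair_val_vanish w l r : F_centered F l -> span_centered r ->
  (l != [::]) || (r != [::]) -> E (val w * cval l * pair_val r) = 0.
Proof.
elim: r w l => [|[b a] r IH] w l hl hr ln.
  by rewrite /pair_val big_nil mulr1 vanish //; move: ln; rewrite orbF.
have [/= hb ha] := hr (b, a) (mem_head _ _).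
have hr' : span_centered r by move=> p pr; apply: hr; rewrite inE pr orbT.
rewrite /pair_val big_cons -/(pair_val r) /=.
elim: ha => [v|c x y _ hx _ hy].
  rewrite mulrA -(mulrA (val w)) -(centered_val_rcons _ _ _ _ _ (b, v)) IH //.
    by apply/F_centered_rcons.
  by case: (l).
have -> : c *: x + y - incBM (E (c *: x + y)) =
    c *: (x - incBM (E x)) + (y - incBM (E y)).
  by rewrite !linearP /= scalerBr scalerN addrACA.
by rewrite mulrDr -scalerAr mulrDl -scalerAl mulrDr -scalerAr linearP /= hx hy scaler0 addr0.
Qed.

Lemma pair_val_span g r : word_span g -> span_centered r -> r != [::] ->
  E (g * pair_val r) = 0.
Proof.
move=> hg hr rn; elim: hg => [w|c x y _ hx _ hy].
  by rewrite -[val w]mulr1 -(centered_val_nil incDB incBM E X) pair_val_vanish ?rn.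
by rewrite mulrDl -scalerAl linearP /= hx hy scaler0 addr0.
Qed.

(** Each element of [B] is paired with the algebra element [y] behind it; an unpaired element of [B]
    may remain at the end. As [E(y)] is in [D], centring under [F \o E] gives [E(y) = 0], so [y] is
    its own centring. *)
Lemma alternating_pairs s : alternating algX (range incBM) true s ->
  exists r, span_centered r /\
    ((\prod_(x <- s) x = pair_val r /\ (r = [::] -> s = [::])) \/
     exists2 b, F b = 0 & \prod_(x <- s) x = pair_val r * incBM b).
Proof.
have FE0 b : ED (incBM b) = 0 -> F b = 0.
  by rewrite /= -[incBM b]mulr1 (expectation_mull hE) (proj1 hE) mulr1.
have [N] := ubnP (size s); elim: N s => // N IH [|z [|y s]] hN /=.
- by move=> _; exists [::]; split=> //; left; rewrite /pair_val !big_nil.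
- case=> [[b _ <-]] /FE0 hb _; exists [::]; split=> //; right; exists b => //.
  by rewrite /pair_val big_nil big_seq1 mul1r.
case=> [[b _ <-]] /FE0 hb [/algX_word_span hy ey hs].
have [r [hr h]] := IH s ltac:(by move: hN => /=; lia) hs.
have Ey : E y = 0 by rewrite (word_span_in_D hy); rewrite /= in ey; rewrite ey rmorph0.
have pv : pair_val ((b, y) :: r) = incBM b * y * pair_val r.
  by rewrite /pair_val big_cons /= Ey rmorph0 subr0.
exists ((b, y) :: r); split.
  by move=> p; rewrite inE => /orP[/eqP->|/hr].
rewrite pv !big_cons mulrA; case: h => [[-> _]|[b' hb' ->]]; first by left.
by right; exists b'; rewrite // !mulrA.
Qed.

Lemma vanish_free : free_from incDB incBM ED X.
Proof.
apply/free_amalgP => -[] s sn.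
  move=> /alternating_pairs[r [hr [[-> hs]|[b hb ->]]]] /=.
    rewrite -[pair_val r]mul1r pair_val_span ?linear0 //.
      by rewrite -(word_val_nil incDB incBM X); apply: WordSpanVal.
    by apply: contra_neq sn.
  rewrite (expectation_mulr hE); have [->|rn] := eqVneq r [::].
    by rewrite /pair_val big_nil (proj1 hE) mul1r.
  rewrite -[pair_val r]mul1r pair_val_span ?mul0r ?linear0 //.
  by rewrite -(word_val_nil incDB incBM X); apply: WordSpanVal.
(* A product that begins in the algebra uses the uncentred leading factor, here [x]. *)
case: s sn => // x s _ [/algX_word_span hx ex] /alternating_pairs[r [hr h]].
have Ex : E x = 0 by rewrite (word_span_in_D hx); rewrite /= in ex; rewrite ex rmorph0.
rewrite big_cons /=; case: h => [[-> hs]|[b hb ->]].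
  have [r0|rn] := eqVneq r [::]; last by rewrite pair_val_span ?linear0.
  by rewrite r0 /pair_val big_nil mulr1 Ex linear0.
rewrite mulrA (expectation_mulr hE); have [->|rn] := eqVneq r [::].
  by rewrite /pair_val big_nil mulr1 Ex mul0r linear0.
by rewrite pair_val_span // mul0r linear0.
Qed.
End VanishToFree.

Section FreeToVanish.
Hypothesis F_faithful : forall b1 : B, (forall b2 : B, F (b1 * b2) = 0) -> b1 = 0.
Hypothesis hfree : free_from incDB incBM ED X.

Lemma alternating_free c s : s != [::] -> alternating algX (range incBM) c s ->
  F (E (\prod_(x <- s) x)) = 0.
Proof. by move: c s; apply/free_amalgP. Qed.

Definition F_center b := b - incDB (F b).

Lemma F_F_center b : F (F_center b) = 0.
Proof. by rewrite linearB /= (F_inc hF) subrr. Qed.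

Lemma ED_inc b : F (E (incBM b)) = F b.
Proof. by rewrite -[incBM b]mulr1 (expectation_mull hE) (proj1 hE) mulr1. Qed.

(** The part of a test element in [D] contributes [F(e) d = 0], so F-centred test elements suffice;
    these are the ones that freeness can handle. *)
Lemma faithful_center e : F e = 0 -> (forall b, F b = 0 -> F (e * b) = 0) -> e = 0.
Proof.
move=> he h; apply: F_faithful => b.
have -> : b = F_center b + incDB (F b) by rewrite subrK.
by rewrite mulrDr linearD /= h ?F_F_center // add0r (F_mulr hF) he mul0r.
Qed.

Lemma ED_center x : F (E (x - incBM (incDB (ED x)))) = 0.
Proof. by rewrite !linearB /= ED_inc (F_inc hF) subrr. Qed.

Lemma algX_center w : algX (val w - incBM (incDB (ED (val w)))).
Proof.
apply: word_span_algX; rewrite addrC -scaleN1r.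
have -> : incBM (incDB (ED (val w))) = val [:: inr (ED (val w))].
  by rewrite /word_val big_seq1.
by apply: WordSpanLinear; apply: WordSpanVal.
Qed.

(** The defect [E(w) - F(E(w))] is [E(x)] for the centred element [x], and [F(E(x) b)] is the
    expectation of the alternating product of [x] and [b]. *)
Lemma free_val_in_D w : E (val w) = incDB (F (E (val w))).
Proof.
pose x := val w - incBM (incDB (ED (val w))).
have Ex : E x = F_center (E (val w)).
  by rewrite linearB /= -[incBM _]mulr1 (expectation_mull hE) (proj1 hE) mulr1.
apply/eqP; rewrite -subr_eq0 -/(F_center _) -Ex; apply/eqP.
apply: faithful_center => [|b hb]; first exact: ED_center.
rewrite -(expectation_mulr hE); have := @alternating_free false [:: x; incBM b] isT.
rewrite big_cons big_seq1; apply; split; rewrite /= ?ED_center //; first exact: algX_center.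
by split; rewrite /= ?ED_inc //; exists b.
Qed.

Definition centered_seq l :=
  flatten [seq [:: incBM p.1; val p.2 - incBM (E (val p.2))] | p <- l].

Lemma prod_centered_seq l : \prod_(x <- centered_seq l) x = cval l.
Proof.
elim: l => [|p l IH]; first by rewrite big_nil centered_val_nil.
by rewrite !big_cons IH centered_val_cons mulrA.
Qed.

Lemma alternating_centered_seq l s : F_centered F l ->
  alternating algX (range incBM) true s -> alternating algX (range incBM) true (centered_seq l ++ s).
Proof.
move=> hl hs; elim: l hl => //= p l IH hl; split; first by exists p.1.
  by rewrite /= ED_inc; apply: hl; rewrite mem_head.
rewrite (free_val_in_D p.2) /=; split; rewrite ?ED_center //; first exact: algX_center.
by apply: IH => q ql; apply: hl; rewrite inE ql orbT.
Qed.

(** Split [w] into its centring [x] and a scalar from [D]. Both resulting products are alternating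
    and end in the algebra, so a test element of [B] may be appended for [faithful_center]. *)
Lemma free_vanish w l : F_centered F l -> l != [::] -> E (val w * cval l) = 0.
Proof.
move=> hl ln; pose x := val w - incBM (incDB (ED (val w))).
have csn : centered_seq l != [::] by case: (l) ln.
have h0 s : alternating algX (range incBM) true s ->
    F (E (cval l * \prod_(y <- s) y)) = 0.
  move=> hs; rewrite -prod_centered_seq -big_cat; apply: (@alternating_free true).
    by case: (centered_seq l) csn.
  exact: alternating_centered_seq.
have h1 s : alternating algX (range incBM) true s ->
    F (E (x * (cval l * \prod_(y <- s) y))) = 0.
  move=> hs; have -> : x * (cval l * \prod_(y <- s) y) = \prod_(y <- x :: centered_seq l ++ s) y.
    by rewrite big_cons big_cat prod_centered_seq.
  apply: (@alternating_free false) => //; split.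
  - exact: algX_center.
  - exact: ED_center.
  - exact: alternating_centered_seq.
have hb b : F b = 0 -> alternating algX (range incBM) true [:: incBM b].
  by move=> fb; split; rewrite /= ?ED_inc //; exists b.
have e0 : E (cval l) = 0.
  apply: faithful_center => [|b /hb h]; first by have := h0 [::] I; rewrite big_nil mulr1.
  by have := h0 _ h; rewrite big_seq1 (expectation_mulr hE).
have e1 : E (x * cval l) = 0.
  apply: faithful_center => [|b /hb h]; first by have := h1 [::] I; rewrite big_nil mulr1.
  by have := h1 _ h; rewrite big_seq1 mulrA (expectation_mulr hE).
have -> : val w = x + incBM (incDB (ED (val w))) by rewrite subrK.
by rewrite mulrDl linearD /= e1 (expectation_mull hE) e0 mulr0 addr0.
Qed.
End FreeToVanish.
End Freeness.

(** * The cumulant of highest order *)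

Section TopTerm.
Context {K : pzRingType} {D B M : algType K}.
Variables (incDB : {lrmorphism D -> B}) (incBM : {lrmorphism B -> M}).
Variables (E : {linear M -> B}) (n : nat) (X : 'I_n -> M).
Hypothesis (hE : cond_exp incBM E).
Local Notation word := (seq ('I_n + D)).
Implicit Types (Phi : M -> seq M -> B) (g : M) (acc : seq M) (w : word)
  (l : seq (B * word)) (q : seq ('I_n * (D + B))).

Local Notation deg := (@word_deg _ D n).
Local Notation cdeg := (@centered_deg _ D B n).
Local Notation wscan := (word_scan incDB incBM E X).
Local Notation cscan := (centered_scan incDB incBM E X).
Local Notation start := (scan_start incBM E).

Definition vanish_below s Phi := forall g acc, (size acc < s)%N -> Phi g acc = 0.

Lemma vanish_below_le s s' Phi : (s' <= s)%N -> vanish_below s Phi -> vanish_below s' Phi.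
Proof. by move=> le h g acc ha; apply: h; apply: leq_trans ha le. Qed.

Lemma letter_op_below s m Phi : vanish_below s.+1 Phi ->
  vanish_below s (letter_op incBM E m Phi).
Proof. by move=> h g acc ha; rewrite /letter_op !h ?addr0 //= ltnW. Qed.

Lemma scalar_op_below s b Phi : vanish_below s Phi -> vanish_below s (scalar_op incBM b Phi).
Proof. by move=> h g acc; apply: h. Qed.

(** A scan of [w] lengthens the block by at most the number of letters of [w]. *)
Lemma word_scan_below s w Phi : vanish_below (deg w + s) Phi -> vanish_below s (wscan w Phi).
Proof.
elim: w Phi => [|y w IH] Phi h //; apply: IH; case: y h => [i|d] h /=.
  exact: letter_op_below.
exact: scalar_op_below.
Qed.

Lemma centered_scan_below s l Phi : vanish_below (cdeg l + s) Phi -> vanish_below s (cscan l Phi).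
Proof.
elim: l Phi => [|[b w] l IH] Phi h //; apply: IH => g acc ha; rewrite /centered_op.
have h' : vanish_below (deg w + (cdeg l + s)) Phi by rewrite addnA.
rewrite (word_scan_below (s := cdeg l + s)) //; last exact: scalar_op_below.
by rewrite /scalar_op h' ?subr0 //; lia.
Qed.

(* The coefficients between the letters are either in [D] or F-centred elements
   of [B]; the latter cut the list into words. *)
Definition coef (c : D + B) : B := match c with inl d => incDB d | inr b => b end.

Definition pattern_args q j : seq M :=
  rcons [seq X p.1 * incBM (coef p.2) | p <- q] (X j).

(** The product of these words is chosen so that the cumulant of [pattern_args q j] is the only term
    of top order in its expectation. *)
Fixpoint pattern_words q j : word * seq (B * word) :=
  match q with
  | [::] => ([:: inl j], [::])
  | (i, inl d) :: q' => let p := pattern_words q' j in (inl i :: inr d :: p.1, p.2)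
  | (i, inr b) :: q' => ([:: inl i], (b, (pattern_words q' j).1) :: (pattern_words q' j).2)
  end.

Lemma pattern_words_head q j : exists i w, (pattern_words q j).1 = inl i :: w.
Proof. by case: q => [|[i [d|b]] q] /=; eexists; eexists. Qed.

Lemma pattern_words_deg q j :
  (deg (pattern_words q j).1 + cdeg (pattern_words q j).2 = (size q).+1)%N.
Proof.
elim: q => [//|[i [d|b]] q IH] /=; first by rewrite -IH.
by rewrite /centered_deg /= -/(cdeg _) IH.
Qed.

(** Only the branch with all letters in the block reaches the required length; its gaps contain
    coefficients only. *)
Lemma pattern_scan q j Phi : vanish_below (size q).+1 Phi ->
  cscan (pattern_words q j).2 (wscan (pattern_words q j).1 Phi) 1 [::] = Phi 1 (pattern_args q j).
Proof.
have E1 b : E (incBM b * 1) = b by rewrite (expectation_mull hE) (proj1 hE) mulr1.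
elim: q Phi => [|[i c] q IH] Phi h.
  change (Phi (X j * 1) [::] + Phi 1 [:: X j * incBM (E 1)] = Phi 1 [:: X j]).
  by rewrite (h (X j * 1)) // add0r (proj1 hE) rmorph1 mulr1.
have sp : size (pattern_args q j) = (size q).+1 by rewrite size_rcons size_map.
have hb b : vanish_below (size q).+1 (scalar_op incBM b (letter_op incBM E (X i) Phi)).
  by apply: scalar_op_below; apply: letter_op_below.
have last_step b : scalar_op incBM b (letter_op incBM E (X i) Phi) 1 (pattern_args q j) =
    Phi 1 (X i * incBM b :: pattern_args q j).
  by rewrite /scalar_op /letter_op (h (X i * _)) ?sp // add0r E1.
case: c {h} => [d|b]; first by rewrite /= -(last_step (incDB d)) -IH.
set Phi' := scalar_op incBM b (letter_op incBM E (X i) Phi).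
transitivity (cscan (pattern_words q j).2 (wscan (pattern_words q j).1 Phi') 1 [::] -
    cscan (pattern_words q j).2
      (scalar_op incBM (E (word_val incDB incBM X (pattern_words q j).1)) Phi') 1 [::]).
  by rewrite -centered_scan_sub; apply: centered_scan_ext.
(* The subtracted term replaces a word by a scalar and loses at least one letter, since each of
   these words begins with a letter; hence the bound 1. *)
rewrite (IH _ (hb b)) (centered_scan_below (s := 1)) // ?subr0; first exact: last_step.
apply: scalar_op_below; apply: vanish_below_le (hb b).
have [i' [w' e]] := pattern_words_head q j.
by rewrite -(pattern_words_deg q j) e addnC leq_add2r.
Qed.

Lemma pattern_start q j i w l delta :
  pattern_words q j = (inl i :: w, l) ->
  (forall v, (size v < (size q).+1)%N -> delta v = 0) ->
  cscan l (wscan w (start (X i) delta)) 1 [::] = delta (pattern_args q j).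
Proof.
(* As [Phi] ignores the gap, the start functional is [letter_op] of [Phi] minus [Phi]; the
   subtracted scan is one letter short and vanishes. *)
move=> e hd; pose Phi (_ : M) acc := delta acc.
have hP : vanish_below (size q).+1 Phi by move=> g acc; apply: hd.
rewrite -[RHS]/(Phi 1 _) -(pattern_scan j hP) e /=.
have hs := pattern_words_deg q j; rewrite e /= in hs.
have -> : cscan l (wscan w (start (X i) delta)) 1 [::] =
    cscan l (wscan w (letter_op incBM E (X i) Phi)) 1 [::] - cscan l (wscan w Phi) 1 [::].
  rewrite -centered_scan_sub; apply: centered_scan_ext => g acc.
  rewrite -scan_sub; apply: word_scan_ext => g' acc'.
  by rewrite /letter_op /Phi addrC addKr.
rewrite [X in _ - X](centered_scan_below (s := 1)) ?subr0 //; apply: word_scan_below.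
by apply: vanish_below_le hP; move: hs; rewrite /= ; lia.
Qed.

Section Truncation.
Variables (kappa : seq M -> B).
Hypothesis hk : is_cumulants incBM E kappa.

Definition truncate N (v : seq M) : B := if (size v < N)%N then kappa v else 0.

Lemma truncate_multilinear N : multilinear (truncate N).
Proof.
case: hk => lin _ _ u v a x y; rewrite /truncate !size_cat /=.
by case: ifP => _; rewrite ?lin ?scaler0 ?addr0.
Qed.

(* The expectation determines the cumulant of highest order through the
   cumulants of lower order. *)
Lemma kappa_pattern q j i w l : pattern_words q j = (inl i :: w, l) ->
  kappa (pattern_args q j) =
  E (word_val incDB incBM X (inl i :: w) * centered_val incDB incBM E X l) -
  cscan l (wscan w (start (X i) (truncate (size q).+1))) 1 [::].
Proof.
move=> e; rewrite word_val_cons (expectation_centered incDB X hE hk).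
pose delta v := kappa v - truncate (size q).+1 v.
have -> : kappa (pattern_args q j) = delta (pattern_args q j).
  by rewrite /delta /truncate size_rcons size_map ltnn subr0.
rewrite -(pattern_start e); last by move=> v hv; rewrite /delta /truncate hv subrr.
rewrite -centered_scan_sub; apply: centered_scan_ext => g acc.
by rewrite -scan_sub.
Qed.
End Truncation.
End TopTerm.

(** * From vanishing products to cumulants, and back *)

Section Equivalence.
Context {K : pzRingType} {D B M : algType K}.
Variables (incDB : {lrmorphism D -> B}) (incBM : {lrmorphism B -> M}).
Variables (E : {linear M -> B}) (F : {linear B -> D}) (n : nat) (X : 'I_n -> M).
Hypotheses (hE : cond_exp incBM E) (hF : cond_exp incDB F).
Variables (kB : seq M -> B) (kD : seq M -> D).
Hypotheses (hkB : is_cumulants incBM E kB) (hkD : is_cumulants (incBM \o incDB) (F \o E) kD).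
Local Notation word := (seq ('I_n + D)).
Implicit Types (p : seq ('I_n * B)) (q : seq ('I_n * (D + B))) (r : seq ('I_n * D)).

Local Notation val := (word_val incDB incBM X).
Local Notation cval := (centered_val incDB incBM E X).
Local Notation incDM := (incBM \o incDB).
Local Notation ED := (F \o E).

Definition X_list p := [seq X t.1 * incBM t.2 | t <- p].

Lemma X_args_list v : X_args incBM X v -> exists p, v = X_list p.
Proof.
elim: v => [|x v IH] h; first by exists [::].
have [i [b ->]] := h x (mem_head _ _).
by have [y yv|p ->] := IH; [apply: h; rewrite inE yv orbT | exists ((i, b) :: p)].
Qed.

Lemma X_args_rcons v : X_args incBM X v -> v != [::] ->
  exists p j b, v = rcons (X_list p) (X j * incBM b).
Proof.
move=> /X_args_list[p ->]; case/lastP: p => // p [j b] _.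
by exists p, j, b; rewrite /X_list map_rcons.
Qed.

Lemma kB_mulr v j b : kB (rcons v (X j * incBM b)) = kB (rcons v (X j)) * b.
Proof. by case: hkB => _ [_ h _] _; apply: h. Qed.

Section Kill.
Hypothesis kill0 : forall p j, (exists2 t, t \in p & F t.2 = 0) -> kB (rcons (X_list p) (X j)) = 0.

Lemma kill_args v i b acc : X_args incBM X v -> X_args incBM X acc -> acc != [::] ->
  F b = 0 -> kB (v ++ X i * incBM b :: acc) = 0.
Proof.
move=> /X_args_list[p ->] ha an hb; have [p' [j [b' ->]]] := X_args_rcons ha an.
rewrite -cat_rcons -rcons_cat kB_mulr.
have -> : rcons (X_list p) (X i * incBM b) ++ X_list p' = X_list (rcons p (i, b) ++ p').
  by rewrite /X_list map_cat map_rcons.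
rewrite kill0 ?mul0r //; exists (i, b) => //.
by rewrite mem_cat mem_rcons mem_head.
Qed.

(** Coefficients are replaced one at a time; each replacement changes the cumulant by one with an
    F-centred coefficient. *)
Lemma kill_center p j :
  kB (rcons (X_list p) (X j)) = kB (rcons (X_list [seq (t.1, incDB (F t.2)) | t <- p]) (X j)).
Proof.
suff h p0 : kB (rcons (X_list p0 ++ X_list p) (X j)) =
    kB (rcons (X_list p0 ++ X_list [seq (t.1, incDB (F t.2)) | t <- p]) (X j)).
  exact: (h [::]).
elim: p p0 => [//|[i b] p IH] p0; rewrite /= -!cat_rcons.
have e c : rcons (X_list p0) (X i * incBM c) = X_list (rcons p0 (i, c)).
  by rewrite /X_list map_rcons.
rewrite e -[LHS]subr0 -(kill0 (p := rcons p0 (i, F_center incDB F b) ++ p) j); last first.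
  exists (i, F_center incDB F b); first by rewrite mem_cat mem_rcons mem_head.
  exact: F_F_center.
rewrite e -IH /X_list !map_cat !map_rcons /= -/(X_list _) -!cats1 -!catA !cat_cons /=.
have kl : multilinear kB by case: hkB.
have -> : X i * incBM (F_center incDB F b) = (-1) *: (X i * incBM (incDB (F b))) + X i * incBM b.
  by rewrite scaleN1r /F_center rmorphB mulrBr addrC.
by rewrite kl scaleN1r opprD opprK addrCA subrr addr0.
Qed.
End Kill.

Section Free.
Hypothesis valD : forall w, E (val w) = incDB (F (E (val w))).
Hypothesis vanish : forall w l, F_centered F l -> l != [::] -> E (val w * cval l) = 0.

Definition centered_pattern q := forall t b, t \in q -> t.2 = inr b -> F b = 0.

Lemma pattern_words_centered q j : centered_pattern q ->
  F_centered F (pattern_words q j).2.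
Proof.
elim: q => [//|[i [d|b]] q IH] h /=.
  by apply: IH => t b' tq; apply: h; rewrite inE tq orbT.
have hq : centered_pattern q by move=> t b' tq; apply: h; rewrite inE tq orbT.
by move=> t; rewrite inE => /orP[/eqP->|/(IH hq)//]; apply: (h (i, inr b)); rewrite ?mem_head.
Qed.

Lemma pattern_words_nonnil q j : has (fun t => if t.2 is inr _ then true else false) q ->
  (pattern_words q j).2 != [::].
Proof. by elim: q => [//|[i [d|b]] q IH]. Qed.

(** In [kappa_pattern] the expectation vanishes by hypothesis, and the lower-order part by
    [centered_scan_vanish] for the truncation, to which the induction hypothesis on shorter lists
    applies. *)
Lemma kill_pattern q j : centered_pattern q ->
  has (fun t => if t.2 is inr _ then true else false) q ->
  (forall p j', (size p < size q)%N -> (exists2 t, t \in p & F t.2 = 0) ->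
     kB (rcons (X_list p) (X j')) = 0) ->
  kB (pattern_args incDB incBM X q j) = 0.
Proof.
move=> hc hq IH; case e: (pattern_words q j) => [w0 l].
have [i [w]] := pattern_words_head q j; rewrite e /= => ew; rewrite {}ew in e.
have hl : F_centered F l by have := @pattern_words_centered q j hc; rewrite e.
have ln : l != [::] by have := @pattern_words_nonnil q j hq; rewrite e.
rewrite (kappa_pattern incDB X hE hkB e) vanish // sub0r; apply/eqP; rewrite oppr_eq0; apply/eqP.
apply: (centered_scan_vanish hE hF valD (N := (word_deg w + centered_deg l).+1)) => //.
- by move=> w' l' hl' ln' _; apply: vanish.
- exact: truncate_multilinear hkB _.
move=> v i' b acc hv ha an hb; rewrite /truncate; case: ifP => // hs.
have [p' [j' [b' ea]]] := X_args_rcons ha an; have [p ep] := X_args_list hv.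
move: hs; rewrite {}ea {}ep -cat_rcons -rcons_cat kB_mulr.
have -> : rcons (X_list p) (X i' * incBM b) ++ X_list p' = X_list (rcons p (i', b) ++ p').
  by rewrite /X_list map_cat map_rcons.
rewrite size_rcons ltnS size_map => hs; rewrite IH ?mul0r //.
by exists (i', b) => //; rewrite mem_cat mem_rcons mem_head.
Qed.

(** By multilinearity every coefficient is split into its centring and its part in [D]; [q] holds
    the coefficients already split, [p] the others. *)
Lemma free_kill p j : (exists2 t, t \in p & F t.2 = 0) -> kB (rcons (X_list p) (X j)) = 0.
Proof.
have kl : multilinear kB by case: hkB.
have [N] := ubnP (size p); elim: N p j => // N IHN p j.
pose raw q := [seq (t.1, coef incDB t.2) | t <- q].
suff h q : centered_pattern q -> (size q + size p < N.+1)%N ->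
    has (fun t => if t.2 is inr _ then true else false) q \/ (exists2 t, t \in p & F t.2 = 0) ->
    kB (rcons (X_list (raw q ++ p)) (X j)) = 0.
  by move=> hp ht; apply: (h [::]) => //; right.
elim: p q => [|[i b] p IH] q hc hs ht.
  rewrite cats0; have -> : rcons (X_list (raw q)) (X j) = pattern_args incDB incBM X q j.
    by rewrite /X_list /raw -map_comp.
  apply: kill_pattern => //; first by case: ht => // -[].
  by move=> p' j' hp'; apply: IHN; rewrite /= in hs; lia.
have key c : centered_pattern (rcons q (i, c)) ->
    has (fun t => if t.2 is inr _ then true else false) (rcons q (i, c)) \/
    (exists2 t, t \in p & F t.2 = 0) ->
    kB (X_list (raw q) ++ X i * incBM (coef incDB c) :: rcons (X_list p) (X j)) = 0.
  move=> hc' ht'; rewrite -(IH (rcons q (i, c))) //; last by rewrite size_rcons addSnnS.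
  by rewrite /raw /X_list map_rcons !map_cat map_rcons /= cat_rcons rcons_cat.
have -> : rcons (X_list (raw q ++ (i, b) :: p)) (X j) =
    X_list (raw q) ++ X i * incBM b :: rcons (X_list p) (X j).
  by rewrite /X_list map_cat rcons_cat.
have -> : X i * incBM b = 1 *: (X i * incBM (F_center incDB F b)) + X i * incBM (incDB (F b)).
  by rewrite scale1r -mulrDr -rmorphD subrK.
have hcr c : (forall b', c = inr b' -> F b' = 0) -> centered_pattern (rcons q (i, c)).
  by move=> h t b'; rewrite mem_rcons inE => /orP[/eqP->|/hc]; [apply: h | apply].
rewrite kl scale1r (key (inr (F_center incDB F b))) ?add0r.
(* An F-centred coefficient has no part in [D], so each surviving pattern contains a centred
   entry. *)
- have [fb|nfb] := eqVneq (F b) 0.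
    by rewrite fb !rmorph0 mulr0 kappa_lin0.
  rewrite (key (inl (F b))) //; first exact: hcr.
  rewrite has_rcons orFb; case: ht => [|[t]]; first by left.
  rewrite inE => /orP[/eqP->/eqP|tp ft]; first by rewrite (negbTE nfb).
  by right; exists t.
- by apply: hcr => b' [<-]; apply: F_F_center.
- by left; rewrite has_rcons.
Qed.

Definition XD_list r := [seq X t.1 * incBM (incDB t.2) | t <- r].

Lemma XD_args_list v : XD_args incDB incBM X v -> exists r, v = XD_list r.
Proof.
elim: v => [|x v IH] h; first by exists [::].
have [i [d ->]] := h x (mem_head _ _).
by have [y yv|r ->] := IH; [apply: h; rewrite inE yv orbT | exists ((i, d) :: r)].
Qed.

Lemma kD_mulr v j d : kD (rcons v (X j * incBM (incDB d))) = kD (rcons v (X j)) * d.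
Proof. by case: hkD => _ [_ h _] _; apply: h. Qed.

Fixpoint letters_word r j : word :=
  if r is (i, d) :: r' then inl i :: inr d :: letters_word r' j else [:: inl j].

Lemma letters_word_head r j : exists i w, letters_word r j = inl i :: w.
Proof. by case: r => [|[i d] r] /=; eexists; eexists. Qed.

Lemma pattern_letters (A : algType K) r j :
  @pattern_words K D A n [seq (t.1, inl t.2) | t <- r] j = (letters_word r j, [::]).
Proof. by elim: r => [//|[i d] r IH] /=; rewrite IH. Qed.

Lemma word_val_comp w : word_val idfun incDM X w = val w.
Proof. by apply: eq_bigr => -[i|d]. Qed.

(** By [kappa_pattern], both are the same moment minus a scan of lower-order cumulants; the moments
    agree by [valD], the scans by induction and [word_scan_compare]. *)
Lemma kB_kD r j : kB (rcons (XD_list r) (X j)) = incDB (kD (rcons (XD_list r) (X j))).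
Proof.
have [N] := ubnP (size r); elim: N r j => // N IH r j hr.
have [i [w ew]] := letters_word_head r j.
have eB := pattern_letters B r j; have eD := pattern_letters D r j; rewrite ew in eB eD.
have hED := cond_exp_comp hE hF.
have := kappa_pattern incDB X hE hkB eB; have := kappa_pattern idfun X hED hkD eD.
have -> : pattern_args incDB incBM X [seq (t.1, inl t.2) | t <- r] j = rcons (XD_list r) (X j).
  by rewrite /pattern_args -map_comp.
have -> : pattern_args idfun incDM X [seq (t.1, inl t.2) | t <- r] j = rcons (XD_list r) (X j).
  by rewrite /pattern_args -map_comp.
rewrite !centered_val_nil !mulr1 !size_map word_val_comp => -> ->.
rewrite rmorphB; congr (_ - _); first exact: valD.
rewrite -{1}(word_val_nil incDB incBM X) -[in RHS](word_val_nil incDB incBM X).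
apply: (word_scan_compare (k := word_deg w)) => //; last by rewrite addn0.
move=> w' acc _ ha; rewrite /scan_start /truncate /=; case: ifP => hs; last by rewrite rmorph0.
rewrite -valD.
have ha' : XD_args incDB incBM X (X i * incBM (E (val w')) :: acc).
  by rewrite valD; apply: XD_args_cons.
have [r' er] := XD_args_list ha'.
have : (size r' <= size r)%N by have := congr1 size er; rewrite size_map => <-.
rewrite er; case/lastP: r' {ha'} er => [//|r' [j' d]] _ hs'.
rewrite /XD_list map_rcons kB_mulr -/(XD_list _) kD_mulr rmorphM IH //.
by move: hs'; rewrite size_rcons; lia.
Qed.

Lemma free_cumulants p j : kB (rcons (X_list p) (X j)) =
  incDB (kD (rcons (XD_list [seq (t.1, F t.2) | t <- p]) (X j))).
Proof.
rewrite (kill_center free_kill) -kB_kD; congr (kB (rcons _ _)).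
by rewrite /X_list /XD_list -!map_comp.
Qed.
End Free.

Section Cumulants.
Hypothesis hcum : forall p j, kB (rcons (X_list p) (X j)) =
  incDB (F (kB (rcons (X_list [seq (t.1, incDB (F t.2)) | t <- p]) (X j)))).

Lemma cumulants_free : free_from incDB incBM ED X.
Proof.
have kl : multilinear kB by case: hkB.
(* An F-centred coefficient becomes a zero argument on the right of [hcum]. *)
have kill0 p j : (exists2 t, t \in p & F t.2 = 0) -> kB (rcons (X_list p) (X j)) = 0.
  case=> -[i b] /splitPr[p1 p2] /= hb; rewrite hcum.
  rewrite /X_list !map_cat /= hb !rmorph0 mulr0 rcons_cat kappa_lin0 //.
  by rewrite linear0 rmorph0.
have valD : forall w, E (val w) = incDB (F (E (val w))).
  apply: (val_in_D hE hF hkB) => v hv vn; have [r ev] := XD_args_list hv.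
  move: vn; rewrite {}ev; case/lastP: r => [//|r [j d]] _.
  rewrite /XD_list map_rcons kB_mulr.
  have -> : [seq X t.1 * incBM (incDB t.2) | t <- r] = X_list [seq (t.1, incDB t.2) | t <- r].
    by rewrite /X_list -map_comp.
  by rewrite hcum (F_mull hF) (F_inc hF) rmorphM.
apply: (vanish_free hE valD) => w l.
apply: (expectation_centered_vanish hE hF hkB valD) => v i b acc.
exact: kill_args.
Qed.
End Cumulants.
End Equivalence.

Lemma indexed_pairs (I T : Type) (p : seq (I * T)) (j : I) :
  exists (i : 'I_(size p).+1 -> I) (b : 'I_(size p) -> T),
    [seq (i (widen_ord (leqnSn (size p)) t), b t) | t <- enum 'I_(size p)] = p /\
    i ord_max = j.
Proof.
case: p => [|x0 p].
  have b0 : 'I_0 -> T by case.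
  by exists (fun=> j), b0; split=> //; apply/size0nil; rewrite size_map size_enum_ord.
move: (x0 :: p) => {}p.
exists (fun t => if (t < size p)%N then (nth x0 p t).1 else j), (fun t => (nth x0 p t).2).
rewrite /= ltnn; split=> //; apply: (@eq_from_nth _ x0); rewrite size_map size_enum_ord //.
move=> t ht; rewrite (nth_map (Ordinal ht)) ?size_enum_ord //.
by rewrite -[t]/(val (Ordinal ht)) nth_ord_enum /= ht -surjective_pairing.
Qed.

Lemma cumulant_seriesE (B M : pzRingType) (inc : B -> M) (kappa : seq M -> B) n (X : 'I_n -> M)
    k (i : 'I_k.+1 -> 'I_n) (b : 'I_k -> B) :
  cumulant_series inc kappa X i b =
  kappa (rcons [seq X t.1 * inc t.2 |
                t <- [seq (i (widen_ord (leqnSn k) j), b j) | j <- enum 'I_k]]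
               (X (i ord_max))).
Proof. by rewrite /cumulant_series -map_comp. Qed.

Theorem theorem3p5 (R : realType) (D B M : algType R[i])
  (incDB : {lrmorphism D -> B}) (incDB_inj : injective incDB)
  (incBM : {lrmorphism B -> M}) (incBM_inj : injective incBM)
  (E : {linear M -> B}) (hE : cond_exp incBM E)
  (F : {linear B -> D}) (hF : cond_exp incDB F)
  (F_faithful : forall b1 : B, (forall b2 : B, F (b1 * b2) = 0) -> b1 = 0)
  (kB : seq M -> B) (hkB : is_cumulants incBM E kB)
  (kD : seq M -> D) (hkD : is_cumulants (incBM \o incDB) (F \o E) kD)
  (n : nat) (X : 'I_n -> M) :
  (free_from incDB incBM (F \o E) X <->
   forall (k : nat) (i : 'I_k.+1 -> 'I_n) (b : 'I_k -> B),
     cumulant_series incBM kB X i b =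
     incDB (F (cumulant_series incBM kB X i (incDB \o F \o b))))
  /\
  (free_from incDB incBM (F \o E) X <->
   forall (k : nat) (i : 'I_k.+1 -> 'I_n) (b : 'I_k -> B),
     cumulant_series incBM kB X i b =
     incDB (cumulant_series (incBM \o incDB) kD X i (F \o b))).
Proof.
set free := free_from _ _ _ _; set cumB := forall k i b, _ = incDB (F _).
set cumD := forall k i b, _ = incDB (cumulant_series _ _ _ _ _).
have fD : free -> cumD.
  move=> hfree k i b; rewrite !cumulant_seriesE.
  rewrite -/(X_list incBM X _) (free_cumulants hE hF hkB hkD).
  - by rewrite /XD_list -!map_comp.
  - by move=> w; apply: free_val_in_D.
  - by move=> w l; apply: free_vanish.
(* The right side of [cumD] is unchanged when each coefficient is replaced by its image under [F],
   and it lies in [D]. *)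
have DB : cumD -> cumB.
  move=> h k i b; rewrite (h k i (incDB \o F \o b)) (F_inc hF) h.
  by congr (incDB (kD (rcons _ _))); apply: eq_map => j /=; rewrite (F_inc hF).
have Bf : cumB -> free.
  move=> h; apply: (cumulants_free hE hF hkB) => p j.
  have [i [b [ep ej]]] := indexed_pairs p j.
  have := h _ i b; rewrite !cumulant_seriesE ej => e.
  rewrite -[in LHS]ep -[in RHS]ep /X_list e; congr (incDB (F (kB (rcons _ _)))).
  by rewrite -!map_comp.
by split; split; auto.
Qed.
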